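(* Let $M$ be a manifold and $\varphi:M\to M$ a diffeomorphism, and let $\mathrm{d}$ denote the differential operator of the Hom-Lie algebroid $\varphi^!TM$, so $\langle\mathrm{d}f,x\rangle=x(f)$ for $x\in\Gamma(\varphi^!TM)$, $f\in C^\infty(M)$. (1) If $(C^\infty(M),\{\cdot,\cdot\},\varphi^* )$ is a purely Hom-Poisson algebra (with respect to the usual multiplication of functions), then $(M,\varphi,\pi)$ is a Hom-Poisson manifold, where $\pi\in\Gamma(\wedge^2\varphi^!TM)$ is given by $\{f,g\}=\pi(\mathrm{d}f,\mathrm{d}g)$ for all $f,g\in C^\infty(M)$. (2) Conversely, if $(M,\varphi,\pi)$ is a Hom-Poisson manifold, then $(C^\infty(M),\{\cdot,\cdot\},\varphi^* )$ is a purely Hom-Poisson algebra, where $\{f,g\}=\pi(\mathrm{d}f,\mathrm{d}g)$.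
   Context: Manifolds, bundles and maps are smooth; functions are real-valued. A Hom-Lie algebra $(\mathfrak g,[\cdot,\cdot],\phi)$ is a vector space with a skew-symmetric bilinear bracket and a linear map $\phi$ such that $\phi[x,y]=[\phi(x),\phi(y)]$ and $[\phi(x),[y,z]]+[\phi(y),[z,x]]+[\phi(z),[x,y]]=0$. A purely Hom-Poisson algebra $(\mathfrak A,\mu,\{\cdot,\cdot\},\phi)$ is a vector space $\mathfrak A$ with bilinear maps $\mu,\{\cdot,\cdot\}$ and a linear map $\phi$ such that $(\mathfrak A,\mu)$ is a commutative associative algebra, $(\mathfrak A,\{\cdot,\cdot\},\phi)$ is a Hom-Lie algebra, and $\{x,\mu(y,z)\}=\mu(\phi(y),\{x,z\})+\mu(\{x,y\},\phi(z))$ for all $x,y,z$. $\varphi^*f=f\circ\varphi$. $\varphi^!TM$ is the pullback bundle of $TM$; a section $x$ acts on functions by $x(f)(m)=x_m(f)$, where $x_m\in T_{\varphi(m)}M$. As $\varphi$ is a diffeomorphism, $\Gamma(\varphi^!TM)$ is thereby identified with the set of $(\varphi^*,\varphi^* )$-derivations of $C^\infty(M)$, i.e. linear maps $x$ with $x(fg)=x(f)\varphi^*(g)+\varphi^*(f)x(g)$. On $\Gamma(\varphi^!TM)$ set $\mathrm{Ad}_{\varphi^*}(x)=\varphi^*\circ x\circ(\varphi^* )^{-1}$ and $[x,y]_{\varphi^*}=\varphi^*\circ x\circ(\varphi^* )^{-1}\circ y\circ(\varphi^* )^{-1}-\varphi^*\circ y\circ(\varphi^* )^{-1}\circ x\circ(\varphi^*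 )^{-1}$. Extend $\mathrm{Ad}_{\varphi^*}$ to $\Gamma(\wedge^k\varphi^!TM)$ by $x_1\wedge\cdots\wedge x_k\mapsto\mathrm{Ad}_{\varphi^*}(x_1)\wedge\cdots\wedge\mathrm{Ad}_{\varphi^*}(x_k)$. The Hom-Schouten bracket $\llbracket\cdot,\cdot\rrbracket_{\varphi^!TM}$ is the bilinear map given for $p,q\ge1$ by $$\llbracket x_1\wedge\cdots\wedge x_p,y_1\wedge\cdots\wedge y_q\rrbracket=\sum_{i,j}(-1)^{i+j}[x_i,y_j]_{\varphi^*}\wedge\mathrm{Ad}_{\varphi^*}(x_1\wedge\cdots\widehat{x_i}\cdots\wedge x_p\wedge y_1\wedge\cdots\widehat{y_j}\cdots\wedge y_q).$$ A Hom-Poisson tensor is a bisection $\pi\in\Gamma(\wedge^2\varphi^!TM)$ with $\llbracket\pi,\pi\rrbracket_{\varphi^!TM}=0$ and $\mathrm{Ad}_{\varphi^*}(\pi)=\pi$; then $(M,\varphi,\pi)$ is called a Hom-Poisson manifold. In (1), since $\{f,\cdot\}$ is a $(\varphi^*,\varphi^* )$-derivation, a bisection $\pi$ with $\{f,g\}=\pi(\mathrm{d}f,\mathrm{d}g)$ exists. *)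

(* Defs.v *)
From HB Require Import structures.
From mathcomp Require Import all_boot all_order all_fingroup all_algebra.
From mathcomp Require Import ring.
From mathcomp Require Import all_classical all_reals all_analysis.

Set Implicit Arguments.
Unset Strict Implicit.
Unset Printing Implicit Defensive.

Import Order.TTheory GRing.Theory Num.Theory.
Import numFieldNormedType.Exports.

Local Open Scope classical_set_scope.
Local Open Scope ring_scope.

Section Smooth.
Variables (R : realType) (n : nat).
Implicit Types (U V : set 'rV[R]_n) (f g : 'rV[R]_n -> R).

Fixpoint Ck (k : nat) U f : Prop :=
  match k with
  | 0%N => forall x, U x -> {for x, continuous f}
  | k'.+1 => (forall x, U x -> differentiable f x) /\
             forall i : 'I_n, Ck k' U (fun x => 'D_(delta_mx 0 i) f x)
  end.

Definition smooth_on U f : Prop := forall k, Ck k U f.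

Lemma CkW k U f : Ck k.+1 U f -> Ck k U f.
Proof.
elim: k f => [|k IH] f [df Df] /=.
  by move=> x Ux; apply/differentiable_continuous/df.
by split=> // i; apply: IH.
Qed.

Lemma Ck_sub k U V f : V `<=` U -> Ck k U f -> Ck k V f.
Proof.
move=> VU; elim: k f => [|k IH] f /=; first by move=> cf x /VU; exact: cf.
by move=> [df Df]; split=> [x /VU|i]; [exact: df|exact: IH].
Qed.

Lemma near_eq_differentiable f g (x : 'rV[R]_n) :
  (\forall y \near x, f y = g y) -> differentiable f x -> differentiable g x.
Proof.
move=> fg df; have fgx : f x = g x by exact: nbhs_singleton fg.
apply/diffP.
apply: (@getPex _ (fun dg : {linear 'rV[R]_n -> R} => continuous dg /\
  forall y, g y = g (lim (nbhs x)) + dg (y - lim (nbhs x))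
                  +o_(y \near x) (y - lim (nbhs x)))).
have [dc fE] := (diffP _ _).1 df.
exists ('d f x); split=> //.
have {}fE : f = (fun y => f (lim (nbhs x)) + 'd f x (y - lim (nbhs x)))
    +o_ (nbhs x) (fun y => y - lim (nbhs x)).
  by apply: eqaddoE; apply/funext => y; exact: fE y.
suff gE : g = (fun y => g (lim (nbhs x)) + 'd f x (y - lim (nbhs x)))
    +o_ (nbhs x) (fun y => y - lim (nbhs x)).
  by apply: eqaddoEx => y; rewrite {1}gE; reflexivity.
apply/eqaddoP => e e0.
have := (eqaddoP _ _ _ _).1 fE e e0; apply: filterS2 fg => y fgy.
by rewrite /= !fctE fgy !lim_id// fgx.
Qed.

Lemma Ck_eq k U f g : open U -> (forall x, U x -> f x = g x) ->
  Ck k U f -> Ck k U g.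
Proof.
move=> oU; elim: k f g => [|k IH] f g fg.
  move=> cf x Ux; have nfg : \forall y \near x, f y = g y.
    by near=> y; apply: fg; near: y; exact: open_nbhs_nbhs.
  rewrite /prop_for /continuous_at -fg //; apply: cvg_trans (cf x Ux).
  exact: (@near_eq_cvg _ _ (nbhs x) _ _ _ nfg).
move=> [df Df].
have nfg x : U x -> \forall y \near x, f y = g y.
  by move=> Ux; near=> y; apply: fg; near: y; exact: open_nbhs_nbhs.
split=> [x Ux|i]; first exact: near_eq_differentiable (nfg x Ux) (df x Ux).
apply: IH (Df i) => x Ux; apply: near_eq_derive; exact: nfg.
Unshelve. all: by end_near. Qed.

Lemma Ck_local k U f :
  (forall x, U x -> exists V, [/\ open V, V x & Ck k V f]) -> Ck k U f.
Proof.
elim: k f => [|k IH] f loc /=.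
  by move=> x /loc[V [_ Vx]]; apply.
split=> [x /loc[V [_ Vx [df _]]]|i]; first exact: df.
by apply: IH => x /loc[V [oV Vx [_ Df]]]; exists V; split=> //; exact: Df.
Qed.

Lemma Ck_cst k U (a : R) : open U -> Ck k U (cst a).
Proof.
move=> oU; elim: k a => [|k IH] a /=; first by move=> x _; exact: cst_continuous.
split=> [x _|i]; first exact: differentiable_cst.
by apply: (Ck_eq oU _ (IH 0)) => x _; rewrite derive_cst.
Qed.

Lemma CkD k U f g : open U -> Ck k U f -> Ck k U g -> Ck k U (f \+ g).
Proof.
move=> oU; elim: k f g => [|k IH] f g.
  by move=> cf cg x Ux; exact: (cvgD (cf x Ux) (cg x Ux)).
move=> [df Df] [dg Dg]; split=> [x Ux|i].
  by apply: differentiableD; [exact: df|exact: dg].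
apply: (Ck_eq oU _ (IH _ _ (Df i) (Dg i))) => x Ux.
by rewrite [RHS]deriveD//; apply: diff_derivable; [exact: df|exact: dg].
Qed.

Lemma CkM k U f g : open U -> Ck k U f -> Ck k U g -> Ck k U (f \* g).
Proof.
move=> oU; elim: k f g => [|k IH] f g.
  by move=> cf cg x Ux; exact: (cvgM (cf x Ux) (cg x Ux)).
move=> Cf Cg; have [[df Df] [dg Dg]] := (Cf, Cg); split=> [x Ux|i].
  by apply: differentiableM; [exact: df|exact: dg].
apply: (Ck_eq oU _ (CkD oU (IH _ _ (CkW Cf) (Dg i)) (IH _ _ (CkW Cg) (Df i)))).
move=> x Ux.
by rewrite [RHS]deriveM//; apply: diff_derivable; [exact: df|exact: dg].
Qed.

Lemma Ck_sum k U m (h : 'I_m -> 'rV[R]_n -> R) : open U ->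
  (forall j, Ck k U (h j)) -> Ck k U (fun x => \sum_j h j x).
Proof.
move=> oU Ch; rewrite -fct_sumE.
elim/big_ind: _ => [|f g Cf Cg|j _]; [exact: Ck_cst|exact: CkD|exact: Ch].
Qed.

Lemma smooth_on_local U f :
  (forall x, U x -> exists V, [/\ open V, V x & smooth_on V f]) ->
  smooth_on U f.
Proof.
move=> loc k; apply: Ck_local => x /loc[V [oV Vx sf]].
by exists V; split=> //; exact: sf.
Qed.

End Smooth.

Lemma Ck_comp (R : realType) (n p k : nat) (U : set 'rV[R]_n)
    (V : set 'rV[R]_p) (g : 'rV[R]_p -> R) (F : 'rV[R]_n -> 'rV[R]_p) :
  open U -> (forall x, U x -> V (F x)) ->
  (forall j, Ck k U (fun x => F x 0 j)) -> Ck k V g -> Ck k U (g \o F).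
Proof.
move=> oU UV; elim: k g => [|k IH] g CF Cg.
  move=> x Ux; apply: continuous_comp; last exact/Cg/UV.
  move=> A [P nP sPA].
  have FF := nbhs_filter x.
  have nF : nbhs x (fun y => forall i j, P i j (F y i j)).
    apply: (@filter_forall _ _ _ _ FF) => i.
    apply: (@filter_forall _ _ _ _ FF) => j; rewrite (ord1 i).
    exact: (CF j x Ux _ (nP 0 j)).
  by apply: (@filterS _ _ FF _ _ _ nF) => y PFy; apply: sPA.
have dF x : U x -> differentiable F x.
  move=> Ux. 
  have -> : F = \sum_j (fun x => F x 0 j *: (delta_mx 0 j)).
    apply/funext => y. rewrite fct_sumE. exact: row_sum_delta.
  apply: differentiable_sum => j; apply: differentiableZl; exact: (CF j).1.
have [dg Dg] := Cg.
split=> [x Ux|i].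
  by apply: differentiable_comp; [exact: dF|exact/dg/UV].
have S : Ck k U (fun x => \sum_j ('D_(delta_mx 0 j) g (F x)) *
                     'D_(delta_mx 0 i) (fun x => F x 0 j) x).
  apply: Ck_sum => // j; apply: CkM => //; last exact: (CF j).2.
  exact: (IH _ (fun l => CkW (CF l)) (Dg j)).
apply: (Ck_eq oU _ S) => x Ux.
have dFx := dF x Ux; have dgx := dg _ (UV x Ux).
rewrite deriveE; last exact: differentiable_comp.
rewrite diff_comp //=; have <- := deriveE (delta_mx 0 i) dFx.
rewrite derive_mx; last exact: diff_derivable.
rewrite [X in 'd g _ X]row_sum_delta linear_sum; apply: eq_bigr => j _.
by rewrite linearZ /= deriveE // mxE mulrC.
Qed.

Definition smooth_map_on (R : realType) (n p : nat) (U : set 'rV[R]_n)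
    (F : 'rV[R]_n -> 'rV[R]_p) : Prop :=
  forall j : 'I_p, smooth_on U (fun x => F x 0 j).

(* A chart is stored with its domain [dom], its image [cod] and a partial     *)
(* inverse [param]; the values of [coord] outside [dom] and of [param]        *)
(* outside [cod] are junk.                                                    *)
Record chart (R : realType) (n : nat) (M : topologicalType) := Chart {
  dom : set M;
  cod : set 'rV[R]_n;
  coord : M -> 'rV[R]_n;
  param : 'rV[R]_n -> M;
  dom_open : open dom;
  cod_open : open cod;
  coord_cod : forall p, dom p -> cod (coord p);
  param_dom : forall x, cod x -> dom (param x);
  coordK : forall p, dom p -> param (coord p) = p;
  paramK : forall x, cod x -> coord (param x) = x;
  coord_continuous : {within dom, continuous coord};
  param_continuous : {within cod, continuous param} }.

Arguments dom_open {R n M} c : rename.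
Arguments cod_open {R n M} c : rename.
Arguments param_continuous {R n M} c : rename.

Record manifold (R : realType) (n : nat) := Manifold {
  carrier :> topologicalType;
  manifold_hausdorff : hausdorff_space carrier;
  manifold_second_countable : @second_countable carrier;
  atlas : set (chart R n carrier);
  atlas_cover : forall p : carrier, exists2 c, atlas c & dom c p;
  atlas_compatible : forall c d, atlas c -> atlas d ->
    smooth_map_on (cod c `&` param c @^-1` dom d) (coord d \o param c) }.
Arguments atlas {R n} m _ : rename.

Definition smooth_fun (R : realType) (n : nat) (M : manifold R n)
    (f : M -> R) : Prop :=
  forall c, atlas M c -> smooth_on (cod c) (f \o param c).

Definition smooth_map (R : realType) (n p : nat) (M : manifold R n)
    (N : manifold R p) (F : M -> N) : Prop :=
  continuous F /\
  forall c d, atlas M c -> atlas N d ->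
    smooth_map_on (cod c `&` (F \o param c) @^-1` dom d)
                  (coord d \o F \o param c).

Lemma smooth_fun_comp (R : realType) (n p : nat) (M : manifold R n)
    (N : manifold R p) (F : M -> N) (f : N -> R) :
  smooth_map F -> smooth_fun f -> smooth_fun (f \o F).
Proof.
move=> [cF sF] sf c Ac; apply: smooth_on_local => x cx.
have [d Ad dFx] := atlas_cover (F (param c x)).
have oV : open (cod c `&` (F \o param c) @^-1` dom d).
  have := param_continuous c; rewrite continuous_open_subspace//; last first.
    exact: cod_open.
  move=> cp.
  rewrite openE => y [cy dy]; apply: filterI.
    by apply: open_nbhs_nbhs; split=> //; exact: cod_open.
  have cFp : {for y, continuous (F \o param c)}.
    by apply: continuous_comp; [apply: cp; exact/mem_set|exact: cF].
  by apply: cFp; apply: open_nbhs_nbhs; split=> //; exact: dom_open.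
exists (cod c `&` (F \o param c) @^-1` dom d); split=> // k.
have sg : Ck k (cod c `&` (F \o param c) @^-1` dom d)
   ((f \o param d) \o (coord d \o F \o param c)).
  apply: (Ck_comp oV _ _ (sf d Ad k)).
    by move=> y [_ dy]; exact: coord_cod.
  by move=> j; exact: sF.
by apply: (Ck_eq oV _ sg) => y [_ dy] /=; rewrite coordK.
Qed.

Section SmoothFunctions.
Variables (R : realType) (n : nat) (M : manifold R n).

Definition smooth_fun_pred : {pred M -> R} := mem [set f : M -> R | smooth_fun f].

Lemma smooth_fun_predP f : reflect (smooth_fun f) (f \in smooth_fun_pred).
Proof. by apply: (iffP idP); rewrite inE. Qed.

Lemma smooth_fun_cst (a : R) : smooth_fun (cst a : M -> R).
Proof. by move=> c Ac k; apply: Ck_cst; exact: cod_open. Qed.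

Lemma smooth_funD (f g : M -> R) : smooth_fun f -> smooth_fun g ->
  smooth_fun (f + g).
Proof.
by move=> sf sg c Ac k; apply: (CkD (cod_open c) (sf c Ac k) (sg c Ac k)).
Qed.

Lemma smooth_funM (f g : M -> R) : smooth_fun f -> smooth_fun g ->
  smooth_fun (f * g).
Proof.
by move=> sf sg c Ac k; apply: (CkM (cod_open c) (sf c Ac k) (sg c Ac k)).
Qed.

Lemma smooth_funZ (a : R) (f : M -> R) : smooth_fun f -> smooth_fun (a *: f).
Proof. exact: (smooth_funM (smooth_fun_cst a)). Qed.

Fact smooth_fun_subring_closed : subring_closed smooth_fun_pred.
Proof.
split=> [|f g /smooth_fun_predP sf /smooth_fun_predP sg|
          f g /smooth_fun_predP sf /smooth_fun_predP sg]; apply/smooth_fun_predP.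
- exact: smooth_fun_cst.
- by apply: smooth_funD => //; rewrite -scaleN1r; exact: smooth_funZ.
- exact: smooth_funM.
Qed.
HB.instance Definition _ :=
  GRing.isSubringClosed.Build (M -> R) smooth_fun_pred smooth_fun_subring_closed.

Fact smooth_fun_scaler_closed : GRing.scaler_closed smooth_fun_pred.
Proof.
by move=> a f /smooth_fun_predP sf; apply/smooth_fun_predP; exact: smooth_funZ.
Qed.
HB.instance Definition _ :=
  GRing.isScaleClosed.Build R (M -> R) smooth_fun_pred smooth_fun_scaler_closed.

Record Cinf := MkCinf { Cinf_fun :> M -> R; _ : Cinf_fun \in smooth_fun_pred }.

HB.instance Definition _ := [isSub for Cinf_fun].
HB.instance Definition _ := [Choice of Cinf by <:].
HB.instance Definition _ := 
  GRing.SubChoice_isSubComPzRing.Build _ _ Cinf (GRing.subringClosedP _).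
HB.instance Definition _ := [SubZmodule_isSubLmodule of Cinf by <:].

Definition mkCinf (f : M -> R) (sf : smooth_fun f) : Cinf :=
  MkCinf (introT (smooth_fun_predP f) sf).

Lemma Cinf_smooth (f : Cinf) : smooth_fun f.
Proof. exact/smooth_fun_predP/valP. Qed.

Lemma CinfP (f g : Cinf) : (f : M -> R) =1 g -> f = g.
Proof. by move=> fg; apply/val_inj/funext. Qed.

End SmoothFunctions.
Arguments mkCinf {R n M} f sf.
Notation "'C^oo' ( M )" := (Cinf M) (at level 8, format "'C^oo' ( M )").

Section HomAlgebras.
Variables (R : pzRingType) (A : lmodType R).
Implicit Types (mu br : A -> A -> A) (phi : A -> A).

Definition bilinear_op mu : Prop :=
  (forall x, linear (mu x)) /\ (forall y, linear (mu ^~ y)).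

Record hom_lie_algebra br phi : Prop := HomLieAlgebra {
  hom_lie_bilinear : bilinear_op br;
  hom_lie_linear : linear phi;
  hom_lie_skew : forall x y, br x y = - br y x;
  hom_lie_morph : forall x y, phi (br x y) = br (phi x) (phi y);
  hom_lie_jacobi : forall x y z,
    br (phi x) (br y z) + br (phi y) (br z x) + br (phi z) (br x y) = 0 }.

Record purely_hom_poisson_algebra mu br phi : Prop := PurelyHomPoissonAlgebra {
  hom_poisson_mul_bilinear : bilinear_op mu;
  hom_poisson_mulC : commutative mu;
  hom_poisson_mulA : associative mu;
  hom_poisson_lie : hom_lie_algebra br phi;
  hom_poisson_leibniz : forall x y z,
    br x (mu y z) = mu (phi y) (br x z) + mu (br x y) (phi z) }.

End HomAlgebras.

Section ExteriorPower.
Variables (R : realType).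

Section Dual.
Variable V : lmodType R.

Definition dual_pred : {pred V -> R} := mem [set u : V -> R | scalar u].

Fact dual_pred_closed : submod_closed dual_pred.
Proof.
split=> [|a u v]; rewrite !inE/=.
  by move=> b x y; rewrite mulr0 addr0.
move=> su sv b x y; rewrite !fctE su sv /GRing.scale /=; ring.
Qed.
HB.instance Definition _ := GRing.isSubmodClosed.Build R (V -> R) dual_pred
  dual_pred_closed.

Record dual := Dual { dual_fun :> V -> R; _ : dual_fun \in dual_pred }.
HB.instance Definition _ := [isSub for dual_fun].
HB.instance Definition _ := [Choice of dual by <:].
HB.instance Definition _ := [SubChoice_isSubLmodule of dual by <:].

Definition mkdual (u : V -> R) (su : scalar u) : dual := Dual (mem_set su).

Lemma dual_scalar (u : dual) : scalar u.
Proof. by have := valP u; rewrite inE. Qed.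

End Dual.

Definition multilinear_form k (W : lmodType R) (P : ('I_k -> W) -> R) : Prop :=
  forall (i : 'I_k) (a : R) (u v w : 'I_k -> W),
    u i = a *: v i + w i ->
    (forall j, j != i -> u j = v j /\ u j = w j) ->
    P u = a * P v + P w.

Definition alternating_form k (W : lmodType R) (P : ('I_k -> W) -> R) : Prop :=
  forall (u : 'I_k -> W) (i j : 'I_k), i != j -> u i = u j -> P u = 0.

Section Exterior.
Variables (k : nat) (V : lmodType R).

(* The k-th exterior power of a finite-dimensional V, realized as the space   *)
(* of alternating k-linear forms on the dual of V, with the convention        *)
(* (v_1 /\ .. /\ v_k)(a_1, .., a_k) = det (a_i (v_j)).                        *)
Definition ext_pred : {pred ('I_k -> dual V) -> R} :=
  mem [set P | multilinear_form P /\ alternating_form P].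

Fact ext_pred_closed : submod_closed ext_pred.
Proof.
split=> [|a P Q]; rewrite !inE/=.
  by split=> [i b u v w _ _|//]; rewrite mulr0 addr0.
move=> [mP aP] [mQ aQ]; split=> [i b u v w ui uj|u i j ij uij]; rewrite !fctE.
  by rewrite (mP _ _ _ _ _ ui uj) (mQ _ _ _ _ _ ui uj) /GRing.scale /=; ring.
by rewrite (aP _ _ _ ij uij) (aQ _ _ _ ij uij) scaler0 addr0.
Qed.
HB.instance Definition _ := GRing.isSubmodClosed.Build R
  (('I_k -> dual V) -> R) ext_pred ext_pred_closed.

Record ext := Ext { ext_fun :> ('I_k -> dual V) -> R; _ : ext_fun \in ext_pred }.
HB.instance Definition _ := [isSub for ext_fun].
HB.instance Definition _ := [Choice of ext by <:].
HB.instance Definition _ := [SubChoice_isSubLmodule of ext by <:].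

Lemma ext_multilinear (P : ext) : multilinear_form P.
Proof. by have := valP P; rewrite inE => -[]. Qed.

Lemma ext_alternating (P : ext) : alternating_form P.
Proof. by have := valP P; rewrite inE => -[]. Qed.

Fact wedge_subproof (v : 'I_k -> V) :
  (fun u : 'I_k -> dual V => \det (\matrix_(i, j) u i (v j))) \in ext_pred.
Proof.
rewrite inE /=; split=> [i b u1 u2 u3 ui uj|u i j ij uij].
  rewrite (determinant_multilinear (i0 := i) (b := b) (c := 1)
    (B := \matrix_(i, j) u2 i (v j)) (C := \matrix_(i, j) u3 i (v j))).
  - by rewrite mul1r.
  - by apply/rowP => j; rewrite !mxE ui /= mul1r.
  - apply/matrixP => l j; rewrite !mxE (uj (lift i l) _).1//.
    by rewrite eq_sym neq_lift.
  - apply/matrixP => l j; rewrite !mxE (uj (lift i l) _).2//.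
    by rewrite eq_sym neq_lift.
by apply: (determinant_alternate ij) => l; rewrite !mxE uij.
Qed.
Definition wedge_vec (v : 'I_k -> V) : ext := Ext (wedge_subproof v).

End Exterior.

Section ExteriorMap.
Variables (V W : lmodType R) (L : {linear V -> W}).

Fact dual_map_subproof (u : dual W) : scalar (u \o L).
Proof. by move=> a x y; rewrite /= linearP dual_scalar. Qed.
Definition dual_map (u : dual W) : dual V := mkdual (dual_map_subproof u).

Fact ext_map_subproof k (P : ext k V) :
  (fun u : 'I_k -> dual W => P (dual_map \o u)) \in @ext_pred k W.
Proof.
rewrite inE /=; split=> [i b u1 u2 u3 ui uj|u i j ij uij].
  apply: (@ext_multilinear _ _ P i) => [|j /uj[u12 u13]] /=.
    by apply/val_inj/funext => x; rewrite /= ui.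
  by rewrite -u12 -u13.
by apply: (@ext_alternating _ _ P _ _ _ ij); rewrite /= uij.
Qed.
Definition ext_map k (P : ext k V) : ext k W := Ext (ext_map_subproof P).

Lemma ext_map_wedge k (v : 'I_k -> V) :
  ext_map (wedge_vec v) = wedge_vec (L \o v).
Proof. by apply/val_inj/funext => u /=; congr (\det _). Qed.

End ExteriorMap.

End ExteriorPower.
Arguments dual {R} V.
Arguments ext {R} k V.

Section TangentSpace.
Variables (R : realType) (n : nat) (M : manifold R n) (p : M).

Definition tangent_pred : {pred C^oo(M) -> R} :=
  mem [set v : C^oo(M) -> R |
    scalar v /\ forall f g : C^oo(M), v (f * g) = v f * g p + f p * v g].

Fact tangent_pred_closed : submod_closed tangent_pred.
Proof.
split=> [|a v w]; rewrite !inE/=.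
  by split=> [b f g|f g]; [rewrite mulr0 addr0|rewrite mul0r mulr0 addr0].
move=> [lv dv] [lw dw]; split=> [b f g|f g]; rewrite !fctE /GRing.scale /=.
  by rewrite lv lw /=; ring.
by rewrite dv dw; ring.
Qed.
HB.instance Definition _ := GRing.isSubmodClosed.Build R (C^oo(M) -> R)
  tangent_pred tangent_pred_closed.

Record tangent :=
  Tangent { tangent_fun :> C^oo(M) -> R; _ : tangent_fun \in tangent_pred }.
HB.instance Definition _ := [isSub for tangent_fun].
HB.instance Definition _ := [Choice of tangent by <:].
HB.instance Definition _ := [SubChoice_isSubLmodule of tangent by <:].

Lemma tangent_scalar (v : tangent) : scalar v.
Proof. by have := valP v; rewrite inE => -[]. Qed.

Lemma tangent_leibniz (v : tangent) (f g : C^oo(M)) :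
  v (f * g) = v f * g p + f p * v g.
Proof. by have := valP v; rewrite inE => -[]. Qed.

Definition mktangent (v : C^oo(M) -> R) (lv : scalar v)
    (dv : forall f g : C^oo(M), v (f * g) = v f * g p + f p * v g) : tangent :=
  Tangent (mem_set (conj lv dv)).

Fact differential_subproof (f : C^oo(M)) : scalar (fun v : tangent => v f).
Proof. by move=> a v w. Qed.
Definition differential (f : C^oo(M)) : dual tangent :=
  mkdual (differential_subproof f).

End TangentSpace.

Record diffeo (R : realType) (n : nat) (M : manifold R n) := Diffeo {
  diffeo_fun :> M -> M;
  diffeo_inv : M -> M;
  diffeo_smooth : smooth_map diffeo_fun;
  diffeo_inv_smooth : smooth_map diffeo_inv;
  diffeoK : cancel diffeo_fun diffeo_inv;
  diffeo_invK : cancel diffeo_inv diffeo_fun }.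

Section Pullback.
Variables (R : realType) (n : nat) (M : manifold R n) (phi : diffeo M).

Definition pullback (f : C^oo(M)) : C^oo(M) :=
  mkCinf (f \o phi) (smooth_fun_comp (diffeo_smooth phi) (@Cinf_smooth _ _ _ f)).

Definition pullbackV (f : C^oo(M)) : C^oo(M) :=
  mkCinf (f \o diffeo_inv phi)
    (smooth_fun_comp (diffeo_inv_smooth phi) (@Cinf_smooth _ _ _ f)).

Lemma pullbackK : cancel pullback pullbackV.
Proof. by move=> f; apply: CinfP => m /=; rewrite diffeo_invK. Qed.

Lemma pullbackVK : cancel pullbackV pullback.
Proof. by move=> f; apply: CinfP => m /=; rewrite diffeoK. Qed.

Lemma pullback_linear : linear pullback.
Proof. by move=> a f g; apply: CinfP. Qed.

Lemma pullbackV_linear : linear pullbackV.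
Proof. by move=> a f g; apply: CinfP. Qed.

Lemma pullbackM f g : pullback (f * g) = pullback f * pullback g.
Proof. exact: CinfP. Qed.

Lemma pullbackVM f g : pullbackV (f * g) = pullbackV f * pullbackV g.
Proof. exact: CinfP. Qed.

Record vsection := VSection {
  vsection_at :> forall m : M, tangent (phi m);
  vsection_smooth : forall f : C^oo(M), smooth_fun (fun m => vsection_at m f) }.

Definition vsection_app (x : vsection) (f : C^oo(M)) : C^oo(M) :=
  mkCinf (fun m => x m f) (vsection_smooth x f).

Definition pullback_derivation (D : C^oo(M) -> C^oo(M)) : Prop :=
  linear D /\
  forall f g, D (f * g) = D f * pullback g + pullback f * D g.

Lemma vsection_app_derivation x : pullback_derivation (vsection_app x).
Proof.
split=> [a f g|f g]; apply: CinfP => m /=; first exact: tangent_scalar.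
exact: tangent_leibniz.
Qed.

Section OfDerivation.
Variables (D : C^oo(M) -> C^oo(M)) (hD : pullback_derivation D).

Fact vsection_of_scalar m : scalar (fun f => D f m).
Proof. by move=> a f g; rewrite hD.1. Qed.

Fact vsection_of_leibniz m f g :
  D (f * g) m = D f m * g (phi m) + f (phi m) * D g m.
Proof. by rewrite hD.2. Qed.

Definition vsection_of : vsection := @VSection
  (fun m => mktangent (@vsection_of_scalar m) (@vsection_of_leibniz m))
  (fun f => @Cinf_smooth _ _ _ (D f)).

Lemma vsection_ofK : vsection_app vsection_of = D.
Proof. by apply/funext => f; apply: CinfP. Qed.

End OfDerivation.

Fact Ad_derivation x :
  pullback_derivation (fun f => pullback (vsection_app x (pullbackV f))).
Proof.
have [lx dx] := vsection_app_derivation x; split=> [a f g|f g].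
  by rewrite pullbackV_linear lx pullback_linear.
rewrite pullbackVM dx !pullbackVK.
exact: CinfP.
Qed.

Definition Ad (x : vsection) : vsection := vsection_of (Ad_derivation x).

Definition twisted_comp (x y : vsection) (f : C^oo(M)) : C^oo(M) :=
  pullback (vsection_app x (pullbackV (vsection_app y (pullbackV f)))).

Fact bracket_derivation x y :
  pullback_derivation (fun f => twisted_comp x y f - twisted_comp y x f).
Proof.
have [lx dx] := vsection_app_derivation x.
have [ly dy] := vsection_app_derivation y.
rewrite /twisted_comp; split=> [a f g|f g].
  rewrite !(pullbackV_linear, lx, ly, pullback_linear) scalerBr opprD.
  by rewrite addrACA.
rewrite !pullbackVM dx dy !pullbackVK.
have pVD h1 h2 : pullbackV (h1 + h2) = pullbackV h1 + pullbackV h2.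
  by apply: CinfP.
have pD h1 h2 : pullback (h1 + h2) = pullback h1 + pullback h2.
  by apply: CinfP.
have xD h1 h2 : vsection_app x (h1 + h2) = vsection_app x h1 + vsection_app x h2.
  by rewrite -[h1]scale1r lx !scale1r.
have yD h1 h2 : vsection_app y (h1 + h2) = vsection_app y h1 + vsection_app y h2.
  by rewrite -[h1]scale1r ly !scale1r.
rewrite !(pVD, xD, yD, pD, pullbackVM, dx, dy, pullbackVK, pullbackM).
ring.
Qed.

Definition hom_bracket (x y : vsection) : vsection :=
  vsection_of (bracket_derivation x y).

(* [hom_d f m] is the value at m of df, a section of the dual bundle of       *)
(* phi^! TM, whose fibre at m is the dual of T_(phi m) M.                     *)
Definition hom_d (f : C^oo(M)) (m : M) : dual (tangent (phi m)) :=
  differential (phi m) f.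

Lemma hom_dE f (x : vsection) m : hom_d f m (x m) = vsection_app x f m.
Proof. by []. Qed.

(* Smoothness is tested on differentials, which span the cotangent spaces.    *)
Record msection (k : nat) := MSection {
  msection_at :> forall m : M, ext k (tangent (phi m));
  msection_smooth : forall f : 'I_k -> C^oo(M),
    smooth_fun (fun m => msection_at m (fun i => hom_d (f i) m)) }.

Definition msection_app k (P : msection k) (f : 'I_k -> C^oo(M)) : C^oo(M) :=
  mkCinf (fun m => P m (fun i => hom_d (f i) m)) (msection_smooth P f).

Lemma msectionP k (P Q : msection k) : (forall m, P m = Q m) -> P = Q.
Proof.
case: P Q => [P sP] [Q sQ] /= PQ.
have {}PQ : P = Q by exact: functional_extensionality_dep.
by move: sP; rewrite PQ => sP; congr MSection; exact: Prop_irrelevance.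
Qed.

Fact msection0_smooth k (f : 'I_k -> C^oo(M)) :
  smooth_fun (fun m => (0 : ext k (tangent (phi m))) (fun i => hom_d (f i) m)).
Proof. exact: smooth_fun_cst. Qed.
Definition msection0 k : msection k := @MSection k (fun=> 0) (@msection0_smooth k).

Fact wedge_smooth k (x : 'I_k -> vsection) (f : 'I_k -> C^oo(M)) :
  smooth_fun (fun m => wedge_vec (fun j => x j m) (fun i => hom_d (f i) m)).
Proof.
suff -> : (fun m => wedge_vec (fun j => x j m) (fun i => hom_d (f i) m)) =
    \sum_(s : 'S_k) (-1) ^+ s *: \prod_i (vsection_app (x (s i)) (f i) : M -> R).
  apply/smooth_fun_predP; apply: rpred_sum => s _; apply: rpredZ.
  by apply: rpred_prod => i _; exact: valP.
apply/funext => m /=; rewrite fct_sumE; apply: eq_bigr => s _.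
by rewrite /GRing.scale /= fct_prodE; congr (_ * _); apply: eq_bigr => i _;
  rewrite mxE.
Qed.

Definition wedge k (x : 'I_k -> vsection) : msection k :=
  @MSection k (fun m => wedge_vec (fun j => x j m)) (wedge_smooth x).

Section AdAt.
Variable m : M.

Fact Ad_at_scalar (v : tangent (phi (phi m))) : scalar (v \o pullbackV).
Proof. by move=> a f g; rewrite /= pullbackV_linear tangent_scalar. Qed.

Fact Ad_at_leibniz (v : tangent (phi (phi m))) f g :
  v (pullbackV (f * g)) =
  v (pullbackV f) * g (phi m) + f (phi m) * v (pullbackV g).
Proof. by rewrite pullbackVM tangent_leibniz /= diffeoK. Qed.

Definition Ad_at (v : tangent (phi (phi m))) : tangent (phi m) :=
  mktangent (Ad_at_scalar v) (Ad_at_leibniz v).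

Fact Ad_at_linear : linear Ad_at.
Proof. by move=> a v w; apply/val_inj/funext => f. Qed.
HB.instance Definition _ := GRing.isLinear.Build R _ _ _ Ad_at Ad_at_linear.

End AdAt.

Lemma AdE x m : Ad x m = Ad_at (x (phi m)).
Proof. exact/val_inj/funext. Qed.

Fact Ad_msection_smooth k (P : msection k) (f : 'I_k -> C^oo(M)) :
  smooth_fun (fun m =>
    ext_map (@Ad_at m) (P (phi m)) (fun i => hom_d (f i) m)).
Proof.
suff -> : (fun m => ext_map (@Ad_at m) (P (phi m)) (fun i => hom_d (f i) m)) =
    pullback (msection_app P (fun i => pullbackV (f i))) by exact: Cinf_smooth.
apply/funext => m /=; congr (P (phi m) _).
by apply/funext => i; apply/val_inj/funext.
Qed.

(* The k-th exterior power of Ad; [Ad_msection_wedge] is the formula by which *)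
(* it is prescribed on decomposable sections.                                 *)
Definition Ad_msection k (P : msection k) : msection k :=
  @MSection k (fun m => ext_map (@Ad_at m) (P (phi m))) (Ad_msection_smooth P).

Lemma Ad_msection_wedge k (x : 'I_k -> vsection) :
  Ad_msection (wedge x) = wedge (Ad \o x).
Proof.
apply: msectionP => m; rewrite /= ext_map_wedge; congr wedge_vec; apply/funext => j.
exact/val_inj/funext.
Qed.

Section HomSchouten.
Variables p q : nat.

(* The family [x_i, y_j], Ad x_0, .., Ad x_p, Ad y_0, .., Ad y_q, where the   *)
(* entries Ad x_i and Ad y_j are omitted.                                     *)
Definition hom_schouten_family (x : 'I_p.+1 -> vsection)
    (y : 'I_q.+1 -> vsection) (i : 'I_p.+1) (j : 'I_q.+1)
    (l : 'I_(p + q).+1) : vsection :=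
  match unlift ord0 l with
  | None => hom_bracket (x i) (y j)
  | Some l' => match fintype.split (l' : 'I_(p + q)) with
               | inl a => Ad (x (lift i a))
               | inr b => Ad (y (lift j b))
               end
  end.

Definition hom_schouten_dec (x : 'I_p.+1 -> vsection) (y : 'I_q.+1 -> vsection)
    (m : M) : ext (p + q).+1 (tangent (phi m)) :=
  \sum_(i < p.+1) \sum_(j < q.+1)
    (-1) ^+ (i + j) *: wedge (hom_schouten_family x y i j) m.

End HomSchouten.

Definition locally_sum_of_wedges k (P : msection k) (a : M)
    (s : seq ('I_k -> vsection)) : Prop :=
  \forall m \near a, P m = \sum_(x <- s) wedge x m.

(* B is the Hom-Schouten bracket of P and Q, of degrees p + 1 and q + 1: the  *)
(* bilinear extension of the formula on decomposable sections. Near any given *)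
(* point a section is a finite sum of decomposable ones, and the value of the *)
(* formula at m involves its arguments only on a neighbourhood of phi m.      *)
Definition is_hom_schouten p q (P : msection p.+1) (Q : msection q.+1)
    (B : msection (p + q).+1) : Prop :=
  forall m : M,
    [/\ exists s, locally_sum_of_wedges P (phi m) s,
        exists t, locally_sum_of_wedges Q (phi m) t &
        forall s t, locally_sum_of_wedges P (phi m) s ->
          locally_sum_of_wedges Q (phi m) t ->
          B m = \sum_(x <- s) \sum_(y <- t) hom_schouten_dec x y m].

Lemma is_hom_schouten_unique p q (P : msection p.+1) (Q : msection q.+1) B B' :
  is_hom_schouten P Q B -> is_hom_schouten P Q B' -> B = B'.
Proof.
move=> hB hB'; apply: msectionP => m.
have [[s Ps] [t Qt] BE] := hB m; have [_ _ BE'] := hB' m.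
by rewrite (BE _ _ Ps Qt) (BE' _ _ Ps Qt).
Qed.

Definition hom_poisson_tensor (pi : msection 2) : Prop :=
  is_hom_schouten (p := 1) (q := 1) pi pi (msection0 3) /\ Ad_msection pi = pi.

Definition poisson_bracket (pi : msection 2) (f g : C^oo(M)) : C^oo(M) :=
  msection_app pi (tnth [tuple f; g]).

Lemma poisson_bracketE pi f g m :
  poisson_bracket pi f g m = pi m (tnth [tuple hom_d f m; hom_d g m]).
Proof.
congr (pi m _); apply/funext => i.
by case: i => -[|[|//]] ?; rewrite !(tnth_nth (hom_d f m), tnth_nth f).
Qed.

End Pullback.

(* Main.v *)
(* Write c for the pullback of functions by phi. Composing a (c, c)-derivation *)
(* with c^-1 gives an ordinary derivation, and turns the Hom-Schouten bracket  *)
(* [pi, pi] at m into the ordinary Schouten bracket at phi m of the bivector   *)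
(* P(f, g) = {c^-1 f, c^-1 g}. The latter, evaluated on df, dg, dh, is -2      *)
(* times the cyclic sum of P(P(f, g), h). The invariance Ad pi = pi says that  *)
(* c P(f, g) = {f, g}, and then c (c P(P(f, g), h)) = - {c h, {f, g}}, so that *)
(* [pi, pi] = 0 is the Hom-Jacobi identity. As sections are tested on          *)
(* differentials, one needs that the differentials exhaust the dual of each    *)
(* tangent space and that pi is locally a finite sum of wedges. Both follow    *)
(* from a local frame, which rests on smooth bump functions and on Hadamard's  *)
(* lemma f(x) = f(a) + sum_i (x_i - a_i) g_i(x).                               *)

From HB Require Import structures.
From mathcomp Require Import all_boot all_order all_fingroup all_algebra.
From mathcomp Require Import ring lra.
From mathcomp Require Import all_classical all_reals all_analysis.
Require Import Defs.

Set Implicit Arguments.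
Unset Strict Implicit.
Unset Printing Implicit Defensive.

Import Order.TTheory GRing.Theory Num.Theory.
Import numFieldNormedType.Exports.

Local Open Scope classical_set_scope.
Local Open Scope ring_scope.

(** * Bump functions *)

(** For a purely Hom-Poisson bracket, fixing one argument and a point [m] gives, by the Leibniz
    rule, a tangent vector at [phi m]. So the value at [m] depends only on differentials
    ([bracket_differential]). Since every covector is a differential ([dual_differential]), the
    bracket defines an alternating form on each cotangent space; this is the tensor of part (1),
    built in [tensor_of_bracket].

    For a fixed bisection [pi], bilinearity, skew-symmetry and the Leibniz rule are automatic, so
    both directions reduce to two equivalences. By [poisson_tensor_Ad], invariance under Ad says
    that the pullback respects the bracket. By [hom_schouten_jacobi], for an invariant [pi],
    vanishing of the Hom-Schouten bracket is the Hom-Jacobi identity. The second rests on the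
    computation [hom_schouten_decE] for two wedges, summed over local decompositions in
    [sum_hom_schouten_decE]; [poisson_tensor_local_wedges] shows that such decompositions exist.

    The analytic input is [local_frame]: near any point there are finitely many global functions X_i
    and global derivations D_i with v(f) = sum_i D_i f(q) v(X_i) for every tangent vector v at q. *)

Section FlatFunction.
Variable R : realType.

(** The factor t^-j makes the family, up to linear combinations, stable under differentiation, so
    that one induction gives smoothness of all members. *)
Definition flat (j : nat) (t : R) : R :=
  if 0 < t then t^-1 ^+ j * expR (- t^-1) else 0.

Lemma flat_le0 j t : t <= 0 -> flat j t = 0.
Proof. by rewrite /flat leNgt; case: ifP. Qed.

Lemma flat_gt0 j t : 0 < t -> 0 < flat j t.
Proof.
by move=> t0; rewrite /flat t0 mulr_gt0 ?expR_gt0// exprn_gt0 ?invr_gt0.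
Qed.

Lemma flat_ge0 j t : 0 <= flat j t.
Proof.
by have [/(flat_le0 j)->|/(flat_gt0 j)/ltW] := leP t 0.
Qed.

(** One term of the exponential series gives e^s >= s^(j+2) / (j+2)! at s = 1/t. The exponent 2 is
    what makes the difference quotient at 0 tend to 0. *)
Lemma flat_le j t : flat j t <= j.+2`!%:R * t ^+ 2.
Proof.
have [t0|t0] := leP t 0; first by rewrite flat_le0// mulr_ge0 ?sqr_ge0.
rewrite /flat t0 expRN ler_pdivrMr ?expR_gt0//.
have ti : 0 <= t^-1 by rewrite invr_ge0 ltW.
have := expR_ge1Dxn j.+1 ti; set e := expR _; set N := (j.+2)`! => ete.
have N0 : 0 < N%:R :> R by rewrite ltr0n fact_gt0.
have {}ete : t^-1 ^+ j.+2 <= N%:R * e.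
  by rewrite mulrC -ler_pdivrMr//; apply: le_trans ete; rewrite lerDr.
have -> : t^-1 ^+ j = t^-1 ^+ j.+2 * t ^+ 2.
  by rewrite -addn2 exprD -mulrA -exprMn mulVf ?gt_eqF// expr1n mulr1.
by rewrite [leRHS]mulrAC; apply: ler_wpM2r => //; exact: sqr_ge0.
Qed.

Lemma is_derive_flat (j : nat) (t : R) :
  is_derive t 1 (flat j) (flat j.+2 t - j%:R * flat j.+1 t).
Proof.
case: (ltgtP t 0) => [t0|t0|->].
- rewrite !flat_le0 ?ltW// mulr0 subrr.
  apply: (near_eq_is_derive (f := cst 0)) => //.
  by near=> s; rewrite flat_le0// ltW//; near: s; exact: lt_nbhsl.
- apply: (near_eq_is_derive (f := (fun s : R => s^-1 ^+ j * expR (- s^-1)))).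
    near=> s; rewrite /flat ifT//; near: s; exact: lt_nbhsr.
  have t'0 : t != 0 by rewrite gt_eqF.
  have dV : is_derive t 1 (fun s : R => s^-1) (- t ^- 2).
    by have := is_deriveV t'0 (is_derive_id t 1); rewrite /GRing.scale /= mulr1.
  have dE : is_derive t 1 (fun s => expR (- s^-1)) (expR (- t^-1) * t ^- 2).
    have dN : is_derive t 1 (fun s : R => - s^-1) (t ^- 2).
      by have := is_deriveN dV; rewrite opprK.
    exact: is_derive1_comp.
  have dX := is_deriveX j dV.
  have dM := is_deriveM dX dE.
  have fE : (fun s : R => s^-1) ^+ j * (fun s => expR (- s^-1)) =
      (fun s => s^-1 ^+ j * expR (- s^-1)) :> (R -> R).
    by apply/funext => s; rewrite fctE exprfctE.
  rewrite -fE; apply: (is_derive_eq dM).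
  rewrite /flat t0 exprfctE /GRing.scale /= -!exprVn.
  by case: (j) => [|i]; rewrite ?expr0 /= ?exprS; ring.
- rewrite !flat_le0// mulr0 subrr.
  (* At 0 the quotient is squeezed between 0 and (j+2)! |h| in absolute value. *)
  have lim0 : (h^-1 *: (flat j (h *: 1 + 0) - flat j 0) @[h --> 0^'] --> (0 : R)).
    apply: norm_cvg0.
    apply: (@squeeze_cvgr _ _ _ _ (cst 0) (fun h : R => j.+2`!%:R * `|h|)).
    + near=> h; rewrite normr_ge0 /= (flat_le0 _ (lexx 0)) subr0 addr0.
      have h0 : h != 0 by near: h; exact: nbhs_dnbhs_neq.
      rewrite /GRing.scale /= mulr1 normrM normfV mulrC.
      rewrite ler_pdivrMr ?normr_gt0// -mulrA -expr2 real_normK ?num_real//.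
      by rewrite ger0_norm ?flat_ge0//; exact: flat_le.
    + exact: cvg_cst.
    + rewrite -[X in _ --> X](mulr0 (j.+2`!%:R : R)); apply: cvgMr.
      rewrite -[X in _ --> X](normr0 R).
      by apply: cvg_norm; apply: cvg_within.
  apply: DeriveDef; first by apply: cvgP lim0.
  by apply: cvg_lim.
Unshelve. all: by end_near. Qed.

End FlatFunction.

Section SmoothOn.
Variables (R : realType) (n : nat).
Implicit Types (U V : set 'rV[R]_n) (f g : 'rV[R]_n -> R).

Lemma smooth_on_sub U V f : V `<=` U -> smooth_on U f -> smooth_on V f.
Proof. by move=> VU sf k; exact: Ck_sub VU (sf k). Qed.

Lemma smooth_on_eq U f g : open U -> (forall x, U x -> f x = g x) ->
  smooth_on U f -> smooth_on U g.
Proof. by move=> oU fg sf k; exact: Ck_eq oU fg (sf k). Qed.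

Lemma smooth_on_cst U (a : R) : open U -> smooth_on U (cst a).
Proof. by move=> oU k; exact: Ck_cst. Qed.

Lemma smooth_onD U f g : open U -> smooth_on U f -> smooth_on U g ->
  smooth_on U (f \+ g).
Proof. by move=> oU sf sg k; exact: CkD. Qed.

Lemma smooth_onM U f g : open U -> smooth_on U f -> smooth_on U g ->
  smooth_on U (f \* g).
Proof. by move=> oU sf sg k; exact: CkM. Qed.

Lemma smooth_on_sum U m (h : 'I_m -> 'rV[R]_n -> R) : open U ->
  (forall j, smooth_on U (h j)) -> smooth_on U (fun x => \sum_j h j x).
Proof. by move=> oU sh k; apply: Ck_sum => // j; exact: sh. Qed.

Lemma smooth_on_partial U f i : smooth_on U f ->
  smooth_on U (fun x => 'D_(delta_mx 0 i) f x).
Proof. by move=> sf k; exact: (sf k.+1).2. Qed.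

Lemma smooth_on_differentiable U f x : smooth_on U f -> U x ->
  differentiable f x.
Proof. by move=> sf; exact: (sf 1%N).1. Qed.

Lemma derive_coord (v x : 'rV[R]_n) i :
  'D_v (fun y : 'rV[R]_n => y 0 i) x = v 0 i.
Proof.
have dx := @derivable_id R _ x v.
have := derive_mx dx; rewrite derive_id => /matrixP/(_ 0 i).
by rewrite mxE.
Qed.

Lemma smooth_on_coord U i : open U -> smooth_on U (fun x => x 0 i).
Proof.
move=> oU [|k] /=; first by move=> x _; exact: matrix_normedtype.coord_continuous.
split=> [x _|j]; first exact: differentiable_coord.
apply: (Ck_eq oU _ (Ck_cst k ((delta_mx 0 j : 'rV[R]_n) 0 i) oU)) => x _.
by rewrite /= derive_coord.
Qed.

End SmoothOn.

Section Bump.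
Variable R : realType.

(** The induction on the order of differentiability is uniform in [j], because a derivative shifts
    [j] by one and by two. *)
Lemma smooth_flat j : smooth_on setT (fun u : 'rV[R]_1 => flat j (u 0 0)).
Proof.
move=> k; elim: k j => [|k IH] j.
  move=> x _; apply: (@continuous_comp _ _ _ (fun u : 'rV[R]_1 => u 0 0)).
    exact: matrix_normedtype.coord_continuous.
  apply/differentiable_continuous/derivable1_diffP.
  by have [] := is_derive_flat j (x 0 0).
have dc (x : 'rV[R]_1) : differentiable (fun u : 'rV[R]_1 => u 0 0) x.
  exact: differentiable_coord.
have df (x : 'rV[R]_1) : differentiable (@flat R j) (x 0 0).
  by apply/derivable1_diffP; have [] := is_derive_flat j (x 0 0).
split=> [x _|i].
  exact: (@differentiable_comp _ _ _ _ (fun u : 'rV[R]_1 => u 0 0)).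
have C := Ck_cst k (- j%:R : R) (@openT 'rV[R]_1).
apply: (Ck_eq openT _ (CkD openT (IH j.+2) (CkM openT C (IH j.+1)))) => x _.
rewrite [RHS](@deriveE _ _ _ (@flat R j \o (fun u : 'rV[R]_1 => u 0 0))); last first.
  exact: differentiable_comp.
rewrite diff_comp//=.
have <- := deriveE (delta_mx 0 i) (dc x).
rewrite derive_coord mxE (ord1 i) /= -deriveE//.
have [_ ->] := is_derive_flat j (x 0 0).
by rewrite mulNr.
Qed.

Lemma smooth_on_flat n (U : set 'rV[R]_n) f : open U -> smooth_on U f ->
  smooth_on U (fun x => flat 0 (f x)).
Proof.
move=> oU sf k.
have := @Ck_comp R n 1 k U setT (fun u => flat 0 (u 0 0))
  (fun x => const_mx (f x)) oU (fun=> fun=> I).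
have -> : (fun u : 'rV[R]_1 => flat 0 (u 0 0)) \o (fun x => const_mx (f x)) =
    (fun x => flat 0 (f x)) by apply/funext => x /=; rewrite mxE.
apply; last exact: smooth_flat.
move=> j; have -> : (fun x => (const_mx (f x) : 'rV[R]_1) 0 j) = f.
  by apply/funext => x; rewrite mxE.
exact: sf.
Qed.

(* Equal to 1 for [s <= 0] and to 0 for [1 <= s], with no quotient of flat    *)
(* functions.                                                                 *)
Definition plateau (s : R) : R :=
  (flat 0 (flat 0 1))^-1 * flat 0 (flat 0 1 - flat 0 s).

Lemma plateau_le0 s : s <= 0 -> plateau s = 1.
Proof.
move=> s0; rewrite /plateau (flat_le0 _ s0) subr0 mulVf//.
by rewrite gt_eqF// !flat_gt0.
Qed.

Lemma plateau_ge1 s : 1 <= s -> plateau s = 0.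
Proof.
move=> s1; rewrite /plateau [X in _ * X]flat_le0 ?mulr0// subr_le0.
have s0 : 0 < s by exact: lt_le_trans s1.
by rewrite /flat ltr01 s0 !expr0 !mul1r ler_expR lerN2 lef_pV2 ?posrE.
Qed.

Lemma smooth_on_plateau n (U : set 'rV[R]_n) f : open U -> smooth_on U f ->
  smooth_on U (fun x => plateau (f x)).
Proof.
move=> oU sf; rewrite /plateau.
apply: (smooth_onM oU (smooth_on_cst _ oU)); apply: smooth_on_flat => //.
apply: (smooth_on_eq (f := cst (flat 0 1) \+ (cst (-1) \* (fun x => flat 0 (f x)))) oU).
  by move=> x _ /=; rewrite mulN1r.
apply: smooth_onD => //; first exact: smooth_on_cst.
by apply: smooth_onM => //; [exact: smooth_on_cst|exact: smooth_on_flat].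
Qed.

Lemma bump_exists n (a : 'rV[R]_n) (r : R) : 0 < r ->
  exists rho : 'rV[R]_n -> R, [/\ smooth_on setT rho,
    \forall x \near a, rho x = 1 &
    forall x, r <= `|x - a| -> rho x = 0].
Proof.
move=> r0.
(* The norm is the sup norm, which is not smooth, so a sum of squares replaces it. It is normalised
   so that [s a] is -1 and [s x] is at least 1 as soon as one coordinate of [x - a] reaches [r]. *)
pose s (x : 'rV[R]_n) : R :=
  \sum_i (x 0 i - a 0 i) * (x 0 i - a 0 i) * (2 / r ^+ 2) - 1.
have ss : smooth_on setT s.
  have oT := @openT 'rV[R]_n.
  apply: (smooth_onD oT _ (smooth_on_cst (-1) oT)); apply: smooth_on_sum => // i.
  have sd : smooth_on setT (fun x : 'rV[R]_n => x 0 i - a 0 i).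
    exact: (smooth_onD oT (smooth_on_coord i oT) (smooth_on_cst _ oT)).
  exact: (smooth_onM oT (smooth_onM oT sd sd) (smooth_on_cst _ oT)).
exists (fun x => plateau (s x)); split; first exact: (smooth_on_plateau openT ss).
- have sa : s a < 0.
    by rewrite /s big1 ?sub0r ?oppr_lt0// => i _; rewrite subrr !mul0r.
  have cs : {for a, continuous s} by exact: (ss 0%N).
  near=> x; apply: plateau_le0; apply/ltW.
  by near: x; exact: (cs _ (lt_nbhsl sa)).
- move=> x rx; apply: plateau_ge1; rewrite /s.
  have [i ri] : exists i, r <= `|x 0 i - a 0 i|.
    have [[i ri]|H] := pselect (exists i, r <= `|x 0 i - a 0 i|); first by exists i.
    exfalso; move: rx; apply/negP; rewrite -ltNge.
    rewrite [ltLHS]mx_normrE; apply/bigmax_ltP; split=> // -[i j] _ /=.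
    rewrite !mxE (ord1 i) ltNge; apply/negP => rj; apply: H; exists j.
    by move: rj.
  rewrite (bigD1 i)//= -lerBlDr opprK.
  apply: ler_wpDr.
    apply: sumr_ge0 => j _; rewrite -expr2 mulr_ge0 ?sqr_ge0// divr_ge0//.
    exact: sqr_ge0.
  have -> : (x 0 i - a 0 i) * (x 0 i - a 0 i) = `|x 0 i - a 0 i| ^+ 2.
    by rewrite real_normK ?num_real// expr2.
  rewrite mulrA ler_pdivlMr ?exprn_gt0// mulrC -[1 + 1]/(2 : R).
  by rewrite ler_wpM2r// lerXn2r ?nnegrE// ltW.
Unshelve. all: by end_near. Qed.

End Bump.

(** * Hadamard's lemma *)

Section MeanValue.
Variables (R : realType) (n : nat).
Implicit Types (f : 'rV[R]_n -> R) (x y v : 'rV[R]_n).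

Lemma coord_le_norm v i : `|v 0 i| <= `|v|.
Proof.
rewrite [leRHS]mx_normrE.
exact: (le_bigmax _ (fun ij : 'I_1 * 'I_n => `|v ij.1 ij.2|) (0, i)).
Qed.

Lemma derive_sum_partial f x v : differentiable f x ->
  'D_v f x = \sum_i v 0 i * 'D_(delta_mx 0 i) f x.
Proof.
move=> df; rewrite deriveE// [in LHS](row_sum_delta v) linear_sum.
by apply: eq_bigr => i _; rewrite linearZ /= deriveE.
Qed.

Lemma is_derive_line f y v (s : R) : differentiable f (y + s *: v) ->
  is_derive s 1 (fun s => f (y + s *: v)) ('D_v f (y + s *: v)).
Proof.
move=> df; have dv := @diff_derivable _ _ _ f _ v df.
have E : (fun h : R => h^-1 *: (f (y + (h *: 1 + s) *: v) - f (y + s *: v))) =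
         (fun h => h^-1 *: (f (h *: v + (y + s *: v)) - f (y + s *: v))).
  apply/funext => h; congr (_ *: (f _ - _)).
  by rewrite scalerDl [h *: 1]mulr1 addrCA.
apply: DeriveDef; first by rewrite /derivable /= E.
by rewrite /derive /= E.
Qed.

Lemma mean_value f y v :
  (forall s : R, 0 <= s <= 1 -> differentiable f (y + s *: v)) ->
  exists2 c : R, 0 <= c <= 1 &
    f (y + v) - f y = \sum_i v 0 i * 'D_(delta_mx 0 i) f (y + c *: v).
Proof.
move=> df; have d01 (s : R) : 0 <= s <= 1 ->
    is_derive s 1 (fun s => f (y + s *: v)) ('D_v f (y + s *: v)).
  by move=> /df; exact: is_derive_line.
have [] := @MVT_segment R (fun s => f (y + s *: v))
  (fun s => 'D_v f (y + s *: v)) 0 1 ler01.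
- by move=> s; rewrite in_itv /= => /andP[/ltW s0 /ltW s1]; apply: d01; rewrite s0.
- apply: continuous_in_subspaceT => s; rewrite inE /= in_itv /= => s01.
  by apply/differentiable_continuous/derivable1_diffP; have [] := d01 s s01.
move=> c; rewrite in_itv /= => c01; rewrite scale1r scale0r addr0 subr0 mulr1 => E.
by exists c => //; rewrite E derive_sum_partial//; exact: df.
Qed.

Lemma lipschitz_segment f y v (C : R) :
  (forall s : R, 0 <= s <= 1 -> differentiable f (y + s *: v)) ->
  (forall (s : R) i, 0 <= s <= 1 -> `|'D_(delta_mx 0 i) f (y + s *: v)| <= C) ->
  `|f (y + v) - f y| <= n%:R * C * `|v|.
Proof.
move=> df bf; have [c c01 ->] := mean_value df.
apply: le_trans (ler_norm_sum _ _ _) _.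
apply: (@le_trans _ _ (\sum_(i < n) C * `|v|)).
  apply: ler_sum => i _; rewrite normrM mulrC ler_pM//; last exact: coord_le_norm.
  exact: bf.
by rewrite sumr_const card_ord -[leLHS]mulr_natl mulrA.
Qed.

(** The mean value theorem is used twice: for [f], giving partials at an intermediate point, and
    then for each partial between [y] and that point. Each use costs a factor [n]. *)
Lemma taylor1_segment f y v (C : R) : 0 <= C ->
  (forall s : R, 0 <= s <= 1 -> differentiable f (y + s *: v)) ->
  (forall (s : R) i, 0 <= s <= 1 ->
     differentiable (fun x => 'D_(delta_mx 0 i) f x) (y + s *: v)) ->
  (forall (s : R) i j, 0 <= s <= 1 ->
     `|'D_(delta_mx 0 j) (fun x => 'D_(delta_mx 0 i) f x) (y + s *: v)| <= C) ->
  `|f (y + v) - f y - \sum_i v 0 i * 'D_(delta_mx 0 i) f y|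
    <= n%:R ^+ 2 * C * `|v| ^+ 2.
Proof.
move=> C0 df ddf bf; have [c /andP[c0 c1] ->] := mean_value df.
rewrite -sumrB; apply: le_trans (ler_norm_sum _ _ _) _.
apply: (@le_trans _ _ (\sum_(i < n) `|v| * (n%:R * C * `|v|))); last first.
  rewrite sumr_const card_ord -[leLHS]mulr_natl; lra.
apply: ler_sum => i _; rewrite -mulrBr normrM ler_pM//; first exact: coord_le_norm.
have sc (s : R) : 0 <= s <= 1 -> 0 <= s * c <= 1.
  by move=> /andP[s0 s1]; rewrite mulr_ge0// mulr_ile1.
apply: (@le_trans _ _ (n%:R * C * `|c *: v|)).
  apply: (lipschitz_segment (f := fun x => 'D_(delta_mx 0 i) f x)).
    by move=> s /sc s01; rewrite scalerA; exact: ddf.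
  by move=> s j /sc s01; rewrite scalerA; exact: bf.
rewrite normrZ ger0_norm// ler_wpM2l ?mulr_ge0//.
by rewrite ler_piMl.
Qed.

(** A quadratic remainder is o(|v|), so the linear part is the differential. This replaces an
    exchange of limit and integral in [ray_average_derivative], where such a remainder can simply be
    integrated. *)
Lemma quadratic_differentiable f x (l : 'I_n -> R) (C d : R) : 0 < d ->
  (forall v, `|v| <= d ->
     `|f (x + v) - f x - \sum_i v 0 i * l i| <= C * `|v| ^+ 2) ->
  differentiable f x /\ forall i, 'D_(delta_mx 0 i) f x = l i.
Proof.
move=> d0 H.
pose L (v : 'rV[R]_n) : R := \sum_i v 0 i * l i.
have Llin : linear L.
  move=> a u w; rewrite /L scaler_sumr -big_split; apply: eq_bigr => i _.
  by rewrite !mxE mulrDl /GRing.scale /= mulrA.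
pose LL := GRing.isLinear.Build R _ _ _ L Llin.
pose L' : {linear 'rV[R]_n -> R} := HB.pack L LL.
have cL : continuous L'.
  move=> u; have -> : (L' : _ -> R) = \sum_i (fun v : 'rV[R]_n => v 0 i * l i).
    by apply/funext => v; rewrite fct_sumE.
  apply/differentiable_continuous/differentiable_sum => i.
  by apply: differentiableM; [exact: differentiable_coord|exact: differentiable_cst].
have E : f \o shift x = cst (f x) + L' +o_ (0 : 'rV[R]_n) id.
  apply/eqaddoP => e e0.
  have C1 : 0 < `|C| + 1 by rewrite ltr_wpDl.
  have nd : \forall v \near (0 : 'rV[R]_n), `|v| <= d by exact: nbhs0_le.
  have ne : \forall v \near (0 : 'rV[R]_n), `|v| <= e / (`|C| + 1).
    by apply: nbhs0_le; rewrite divr_gt0.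
  apply: filterS2 nd ne => v vd ve.
  rewrite /= !fctE /= opprD addrA (addrC v).
  apply: (@le_trans _ _ (`|C| * `|v| * `|v|)).
    apply: (@le_trans _ _ (C * `|v| ^+ 2)).
      exact: H.
    by rewrite expr2 mulrA !ler_wpM2r// ler_norm.
  rewrite ler_wpM2r//.
  move: ve; rewrite ler_pdivlMr// => /(le_trans _); apply.
  by rewrite mulrC ler_wpM2l// lerDl.
have dE := diff_unique cL E.
have df : differentiable f x.
  by apply/diff_locallyP; rewrite dE.
split=> // i; rewrite deriveE// dE /= /L (bigD1 i)//= mxE !eqxx mul1r big1 ?addr0//.
by move=> j ji; rewrite mxE eqxx (negbTE ji) mul0r.
Qed.

End MeanValue.

(** * Integrals of continuous functions over the unit interval *)

Section UnitIntegral.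
Variable R : realType.
Implicit Types p q : R -> R.

Definition continuous01 p := forall t : R, 0 <= t <= 1 -> {for t, continuous p}.

Definition integral01 p : R := (\int[lebesgue_measure]_(t in `[0%R, 1%R]) p t)%R.

Lemma continuous01_within p : continuous01 p -> {within `[0%R, 1%R], continuous p}.
Proof.
by move=> cp; apply: continuous_in_subspaceT => t; rewrite inE /= in_itv /=; exact: cp.
Qed.

Lemma continuous01_integrable p : continuous01 p ->
  lebesgue_measure.-integrable `[0%R, 1%R] (EFin \o p).
Proof.
move=> cp; apply: continuous_compact_integrable; first exact: segment_compact.
exact: continuous01_within.
Qed.

Lemma continuous01D p q : continuous01 p -> continuous01 q ->
  continuous01 (p \+ q).
Proof. by move=> cp cq t t01; exact: cvgD (cp t t01) (cq t t01). Qed.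

Lemma continuous01M p q : continuous01 p -> continuous01 q ->
  continuous01 (p \* q).
Proof. by move=> cp cq t t01; exact: cvgM (cp t t01) (cq t t01). Qed.

Lemma continuous01_cst (a : R) : continuous01 (cst a).
Proof. by move=> t _; exact: cst_continuous. Qed.

Lemma continuous01X m : continuous01 (fun t => t ^+ m).
Proof. by move=> t _; exact: exprn_continuous. Qed.

Lemma eq_integral01 p q : (forall t, 0 <= t <= 1 -> p t = q t) ->
  integral01 p = integral01 q.
Proof. by move=> pq; apply: eq_Rintegral => t; rewrite inE /= in_itv /=; exact: pq. Qed.

Lemma integral01D p q : continuous01 p -> continuous01 q ->
  integral01 (fun t => p t + q t) = integral01 p + integral01 q.
Proof. by move=> cp cq; apply: RintegralD => //; exact: continuous01_integrable. Qed.

Lemma integral01Z (a : R) p : continuous01 p ->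
  integral01 (fun t => a * p t) = a * integral01 p.
Proof. by move=> cp; apply: RintegralZl => //; exact: continuous01_integrable. Qed.

Lemma integral01_cst (a : R) : integral01 (fun=> a) = a.
Proof.
rewrite /integral01 Rintegral_cst//=.
have -> : lebesgue_measure `[0%R, 1%R] = 1%E :> \bar R.
  by rewrite lebesgue_measure_itv /= lte_fin ltr01 oppr0 adde0.
exact: mulr1.
Qed.

Lemma integral01_sum n (p : 'I_n -> R -> R) : (forall i, continuous01 (p i)) ->
  continuous01 (fun t => \sum_i p i t) /\
  integral01 (fun t => \sum_i p i t) = \sum_i integral01 (p i).
Proof.
move=> cp; rewrite -fct_sumE.
apply: (big_rec2 (fun q s => continuous01 q /\ integral01 q = s)).
  by split; [exact: continuous01_cst|exact: integral01_cst].
move=> i q s _ [cq <-].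
by split; [exact: continuous01D|exact: integral01D].
Qed.

Lemma integral01_le p (C : R) : continuous01 p ->
  (forall t, 0 <= t <= 1 -> `|p t| <= C) -> `|integral01 p| <= C.
Proof.
move=> cp pC; rewrite -[leRHS]integral01_cst.
have ip := continuous01_integrable cp.
apply: le_trans (le_normr_Rintegral _ ip) _ => //.
apply: le_Rintegral => //.
- apply: (continuous01_integrable (p := fun t => `|p t|)) => t t01.
  by apply: cvg_norm; exact: cp.
- exact: (continuous01_integrable (@continuous01_cst C)).
Qed.

Lemma integral01_derivative (p q : R -> R) : continuous01 q ->
  (forall t : R, 0 <= t <= 1 -> is_derive t 1 p (q t)) ->
  integral01 q = p 1 - p 0.
Proof.
move=> cq dp; rewrite /integral01 /Rintegral.
have cp t : 0 <= t <= 1 -> {for t, continuous p}.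
  by move=> t01; apply/differentiable_continuous/derivable1_diffP; have [] := dp t t01.
have := @continuous_FTC2 R q p 0 1 ltr01 (continuous01_within cq).
move=> -> //.
- split.
  + by move=> t; rewrite in_itv /= => /andP[/ltW t0 /ltW t1];
    have [] := dp t (introT andP (conj t0 t1)).
  + by apply: cvg_at_right_filter; apply: cp; rewrite lexx ler01.
  + by apply: cvg_at_left_filter; apply: cp; rewrite lexx ler01.
- move=> t; rewrite in_itv /= => /andP[/ltW t0 /ltW t1].
  by rewrite derive1E; have [_ ->] := dp t (introT andP (conj t0 t1)).
Qed.

End UnitIntegral.

Lemma compact_norm_ball (R : realType) n (a : 'rV[R]_n) (e : R) :
  compact [set x | `|x - a| <= e].
Proof.
apply: bounded_closed_compact.
  exists (e + `|a|); split; first exact: num_real.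
  move=> M eM x; rewrite /= => xe; apply/ltW; apply: le_lt_trans eM.
  by rewrite -[x](subrK a); apply: le_trans (ler_normD _ _) _; rewrite lerD2r.
have := @preimage_closed _ _ (fun x : 'rV[R]_n => `|x - a|) [set t | t <= e].
apply; last exact: closed_le.
move=> x _; apply: continuous_comp; last exact: norm_continuous.
exact: cvgD cvg_id (cvg_cst _).
Qed.

Section Hadamard.
Variables (R : realType) (n : nat) (a : 'rV[R]_n) (r : R).
Implicit Types (h : 'rV[R]_n -> R) (x v : 'rV[R]_n).

Let ray_ball x (t : R) : ball a r x -> 0 <= t <= 1 -> ball a r (a + t *: (x - a)).
Proof.
rewrite -!ball_normE /= => xr /andP[t0 t1].
rewrite opprD addNKr normrN normrZ ger0_norm// distrC.
by apply: le_lt_trans xr; rewrite distrC ler_piMl.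
Qed.

Let open_ball : open (ball a r).
Proof.
exact: ball_open.
Qed.

Lemma continuous01_ray h m x : smooth_on (ball a r) h -> ball a r x ->
  continuous01 (fun t => t ^+ m * h (a + t *: (x - a))).
Proof.
move=> sh xr; apply: continuous01M; first exact: continuous01X.
move=> t t01; apply: (@continuous_comp _ _ _ (fun t : R => a + t *: (x - a))).
  by apply: cvgD; [exact: cvg_cst|apply: cvgZr_tmp; exact: cvg_id].
exact: (sh 0%N) (ray_ball xr t01).
Qed.

(* Differentiating under the integral sign raises the exponent [m] by one.   *)
Definition ray_average m h x : R :=
  integral01 (fun t => t ^+ m * h (a + t *: (x - a))).

Lemma ball_second_partials_bounded h (e : R) : smooth_on (ball a r) h -> e < r ->
  exists2 C : R, 0 <= C & forall x i j, `|x - a| <= e ->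
    `|'D_(delta_mx 0 j) (fun x => 'D_(delta_mx 0 i) h x) x| <= C.
Proof.
move=> sh er; pose K := [set x | `|x - a| <= e].
have KU : K `<=` ball a r.
  by move=> x; rewrite /K /= -ball_normE /= distrC => /le_lt_trans; apply.
have cK : compact K by exact: compact_norm_ball.
have Cij i j : exists C : R, forall x, K x ->
    `|'D_(delta_mx 0 j) (fun x => 'D_(delta_mx 0 i) h x) x| <= C.
  have sd := smooth_on_partial j (smooth_on_partial i sh).
  have : {within K, continuous
      (fun x => 'D_(delta_mx 0 j) (fun x => 'D_(delta_mx 0 i) h x) x)}.
    by apply: continuous_in_subspaceT => x; rewrite inE => /KU; exact: (sd 0%N).
  move=> /continuous_compact/(_ cK)/compact_bounded[M [_ HM]].
  by exists (M + 1) => x Kx; apply: HM; [rewrite ltrDl|exists x].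
have [c Hc] := choice (fun ij : 'I_n * 'I_n => Cij ij.1 ij.2).
exists (\sum_ij `|c ij|); first exact: sumr_ge0.
move=> x i j Kx; apply: le_trans (Hc (i, j) x Kx) _.
by rewrite (bigD1 (i, j))//=; apply: ler_wpDr; [exact: sumr_ge0|exact: ler_norm].
Qed.

(** The first-order Taylor estimate of [h] at a + t (x - a) with increment t v is uniform in t, so
    integrating it bounds the remainder of the average. The factor t in the increment accounts for
    the new exponent. *)
Lemma ray_average_derivative h m x : smooth_on (ball a r) h -> ball a r x ->
  differentiable (ray_average m h) x /\
  forall i, 'D_(delta_mx 0 i) (ray_average m h) x =
            ray_average m.+1 (fun y => 'D_(delta_mx 0 i) h y) x.
Proof.
move=> sh xr; have {}xr' : `|x - a| < r by move: xr; rewrite -ball_normE /= distrC.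
(* With [e] midway between |x - a| and [r], all segments involved stay in the closed ball of radius
   [e], where compactness bounds the second partials. *)
pose e := (`|x - a| + r) / 2.
have er : e < r by rewrite /e; lra.
have d0 : 0 < e - `|x - a| by rewrite /e; lra.
have [C C0 HC] := ball_second_partials_bounded sh er.
apply: (quadratic_differentiable (C := n%:R ^+ 2 * C) d0) => v vd.
have ray_e (t s : R) : 0 <= t <= 1 -> 0 <= s <= 1 ->
    `|a + t *: (x - a) + s *: (t *: v) - a| <= e.
  move=> /andP[t0 t1] /andP[s0 s1].
  rewrite addrAC (addrC a) addrK scalerA mulrC -scalerA -scalerDr normrZ ger0_norm//.
  apply: le_trans (_ : `|x - a + s *: v| <= _); first by rewrite ler_piMl.
  apply: le_trans (ler_normD _ _) _; rewrite normrZ ger0_norm//.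
  have : s * `|v| <= `|v| by rewrite ler_piMl.
  by move: vd; lra.
have ball_e y : `|y - a| <= e -> ball a r y.
  by rewrite -ball_normE /= distrC => /le_lt_trans; apply.
have xvr : ball a r (x + v).
  apply: ball_e; have -> : x + v = a + 1 *: (x - a) + 1 *: (1 *: v).
    by rewrite !scale1r (addrC a) subrK.
  by apply: ray_e; rewrite lexx ler01.
pose dh i y := 'D_(delta_mx 0 i) h y.
have sdh i : smooth_on (ball a r) (dh i) by exact: smooth_on_partial.
pose ray t := a + t *: (x - a).
have c1 := continuous01_ray (m := m) sh xvr.
have c2 := continuous01_ray (m := m) sh xr.
have c3 i := continuous01_ray (m := m.+1) (sdh i) xr.
have c3' i : continuous01 (fun t => v 0 i * (t ^+ m.+1 * dh i (ray t))).
  by apply: continuous01M (c3 i); exact: continuous01_cst.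
have [c4 E4] := integral01_sum c3'.
have c2' : continuous01 (fun t => (-1) * (t ^+ m * h (ray t))).
  by apply: continuous01M c2; exact: continuous01_cst.
have c4' : continuous01 (fun t => (-1) * \sum_i v 0 i * (t ^+ m.+1 * dh i (ray t))).
  by apply: continuous01M c4; exact: continuous01_cst.
have -> : ray_average m h (x + v) - ray_average m h x -
    \sum_i v 0 i * ray_average m.+1 (dh i) x =
  integral01 (fun t => t ^+ m * h (a + t *: (x + v - a)) +
    (-1) * (t ^+ m * h (ray t)) +
    (-1) * \sum_i v 0 i * (t ^+ m.+1 * dh i (ray t))).
  rewrite integral01D//; last exact: continuous01D.
  rewrite integral01D// !integral01Z// E4 !mulN1r; congr (_ - _ - _).
  by apply: eq_bigr => i _; rewrite integral01Z.
apply: integral01_le; first by apply: continuous01D => //; exact: continuous01D.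
move=> t t01; have /andP[t0 t1] := t01.
have -> : t ^+ m * h (a + t *: (x + v - a)) + (-1) * (t ^+ m * h (ray t)) +
    (-1) * (\sum_i v 0 i * (t ^+ m.+1 * dh i (ray t))) =
  t ^+ m * (h (ray t + t *: v) - h (ray t) - \sum_i (t *: v) 0 i * dh i (ray t)).
  have -> : a + t *: (x + v - a) = ray t + t *: v.
    by rewrite /ray [x + v - a]addrAC scalerDr addrA.
  rewrite !mulrBr !mulN1r mulr_sumr; congr (_ - _ - _).
  by apply: eq_bigr => i _; rewrite mxE exprS; ring.
rewrite normrM ger0_norm ?exprn_ge0//.
apply: le_trans (_ : `|h (ray t + t *: v) - h (ray t) -
  \sum_i (t *: v) 0 i * dh i (ray t)| <= _).
  by rewrite ler_piMl// exprn_ile1.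
apply: (@le_trans _ _ (n%:R ^+ 2 * C * `|t *: v| ^+ 2)).
  apply: taylor1_segment => //.
  - by move=> s s01; apply: smooth_on_differentiable sh (ball_e _ (ray_e t s t01 s01)).
  - move=> s i s01.
    exact: smooth_on_differentiable (sdh i) (ball_e _ (ray_e t s t01 s01)).
  - by move=> s i j s01; apply: HC; exact: ray_e.
rewrite ler_wpM2l ?mulr_ge0 ?sqr_ge0// normrZ ger0_norm//.
rewrite lerXn2r ?nnegrE ?mulr_ge0//.
by rewrite ler_piMl.
Qed.

(** Partials of ray averages are again ray averages, of the partials of [h]; hence the induction
    generalises both [h] and [m]. *)
Lemma ray_average_smooth h m : smooth_on (ball a r) h ->
  smooth_on (ball a r) (ray_average m h).
Proof.
move=> sh k; elim: k h m sh => [|k IH] h m sh.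
  move=> x xr; apply/differentiable_continuous.
  by have [] := ray_average_derivative m sh xr.
split=> [x xr|i]; first by have [] := ray_average_derivative m sh xr.
apply: (Ck_eq open_ball _ (IH _ m.+1 (smooth_on_partial i sh))) => x xr.
by have [_ ->] := ray_average_derivative m sh xr.
Qed.

(** Integrate the derivative of t |-> h(a + t (x - a)) over the unit interval; [g i] is the average
    of the i-th partial along the ray. *)
Lemma hadamard h : smooth_on (ball a r) h ->
  exists g : 'I_n -> 'rV[R]_n -> R,
    [/\ forall i, smooth_on (ball a r) (g i),
        forall i, g i a = 'D_(delta_mx 0 i) h a &
        forall x, ball a r x -> h x = h a + \sum_i (x 0 i - a 0 i) * g i x].
Proof.
move=> sh; pose dh i y := 'D_(delta_mx 0 i) h y.
have sdh i : smooth_on (ball a r) (dh i) by exact: smooth_on_partial.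
exists (fun i => ray_average 0 (dh i)); split.
- by move=> i; exact: ray_average_smooth.
- move=> i; rewrite /ray_average -[RHS]integral01_cst; apply: eq_integral01 => t _.
  by rewrite expr0 mul1r subrr scaler0 addr0.
- move=> x xr; apply/eqP; rewrite addrC -subr_eq eq_sym; apply/eqP.
  have c1 i : continuous01 (fun t =>
      (x 0 i - a 0 i) * (t ^+ 0 * dh i (a + t *: (x - a)))).
    apply: continuous01M; first exact: continuous01_cst.
    exact: continuous01_ray.
  have [c2 E2] := integral01_sum c1.
  have d (t : R) : 0 <= t <= 1 -> is_derive t 1 (fun t => h (a + t *: (x - a)))
      (\sum_i (x 0 i - a 0 i) * (t ^+ 0 * dh i (a + t *: (x - a)))).
    move=> t01; have dt : differentiable h (a + t *: (x - a)).
      exact: smooth_on_differentiable sh (ray_ball xr t01).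
    apply: is_derive_eq (is_derive_line dt) _.
    rewrite derive_sum_partial//; apply: eq_bigr => i _.
    by rewrite !mxE expr0 mul1r.
  have := integral01_derivative c2 d.
  rewrite scale1r scale0r addr0 (addrC a) subrK => <-; rewrite E2.
  by apply: eq_bigr => i _; rewrite integral01Z//; exact: continuous01_ray.
Qed.

End Hadamard.

(** * Functions and tangent vectors on a manifold *)

(** Compactness of [K] is required because a compact image in a Hausdorff manifold is closed, which
    makes extension by zero smooth. *)
Lemma cutoff_exists (R : realType) n (V : set 'rV[R]_n) a : open V -> V a ->
  exists rho K, [/\ compact K, K `<=` V, smooth_on setT rho,
    \forall x \near a, rho x = 1 & forall x, ~ K x -> rho x = 0].
Proof.
move=> oV Va; have /nbhs_ballP[r /= r0 rV] := open_nbhs_nbhs (conj oV Va).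
have r20 : 0 < r / 2 by rewrite divr_gt0.
have [rho [srho rho1 rho0]] := bump_exists a r20.
exists rho, [set x | `|x - a| <= r / 2]; split=> //.
- exact: compact_norm_ball.
- move=> x /= xr; apply: rV; rewrite -ball_normE /= distrC.
  by apply: le_lt_trans xr _; rewrite ltr_pdivrMr// ltr_pMr// ltr1n.
- by move=> x /= /negP; rewrite -ltNge => /ltW; exact: rho0.
Qed.

Section Charts.
Variables (R : realType) (n : nat) (M : manifold R n).
Implicit Types (c d : chart R n M) (p q : M).

Lemma param_continuous_at c x : cod c x -> {for x, continuous (param c)}.
Proof.
move=> cx; have := param_continuous c.
rewrite continuous_open_subspace; last exact: cod_open.
by apply; exact/mem_set.
Qed.

Lemma coord_continuous_at c p : dom c p -> {for p, continuous (coord c)}.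
Proof.
move=> cp; have := @coord_continuous _ _ _ c.
rewrite continuous_open_subspace; last exact: dom_open.
by apply; exact/mem_set.
Qed.

Lemma open_param_preimage c (A : set M) : open A ->
  open (cod c `&` param c @^-1` A).
Proof.
move=> oA; rewrite openE => x [cx Ax]; apply: filterI.
  exact: open_nbhs_nbhs (conj (cod_open c) cx).
exact: (param_continuous_at cx) (open_nbhs_nbhs (conj oA Ax)).
Qed.

Lemma open_coord_preimage c (V : set 'rV[R]_n) : open V ->
  open (dom c `&` coord c @^-1` V).
Proof.
move=> oV; rewrite openE => p [cp Vp]; apply: filterI.
  exact: open_nbhs_nbhs (conj (dom_open c) cp).
exact: (coord_continuous_at cp) (open_nbhs_nbhs (conj oV Vp)).
Qed.

(** Compatibility of the atlas transports smoothness from one chart around each point to all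
    charts. *)
Lemma smooth_fun_local (F : M -> R) :
  (forall p, exists d V, [/\ atlas M d, dom d p, open V, V (coord d p) &
     smooth_on V (F \o param d)]) -> smooth_fun F.
Proof.
move=> loc c Ac; apply: smooth_on_local => x cx.
have [d [V [Ad dp oV Vp sV]]] := loc (param c x).
pose W := cod c `&` param c @^-1` (dom d `&` coord d @^-1` V).
have oW : open W by apply: open_param_preimage; exact: open_coord_preimage.
exists W; split=> // k.
have := @Ck_comp R n n k W V (F \o param d) (coord d \o param c) oW.
move=> /(_ (fun x Wx => Wx.2.2)) Cc.
apply: (Ck_eq oW _ (Cc _ (sV k))); first by move=> y [_ [dy _]] /=; rewrite coordK.
move=> j; apply: Ck_sub (atlas_compatible Ac Ad j k).
by move=> y [cy [dy _]].
Qed.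

Definition chart_ext c (u : 'rV[R]_n -> R) (p : M) : R :=
  if `[< dom c p >] then u (coord c p) else 0.

Lemma chart_ext_in c u p : dom c p -> chart_ext c u p = u (coord c p).
Proof. by move=> cp; rewrite /chart_ext asboolT. Qed.

Lemma chart_ext_out c u p : ~ dom c p -> chart_ext c u p = 0.
Proof. by move=> cp; rewrite /chart_ext asboolF. Qed.

(** The image of [K] is closed, so every point lies either in that image, where the chart itself
    shows smoothness, or in an open set on which the extension is zero. *)
Lemma chart_ext_smooth c u (K V : set 'rV[R]_n) : atlas M c ->
  open V -> V `<=` cod c -> compact K -> K `<=` V -> smooth_on V u ->
  (forall x, ~ K x -> u x = 0) -> smooth_fun (chart_ext c u).
Proof.
move=> Ac oV VC cK KV su u0; apply: smooth_fun_local => p.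
have cL : closed (param c @` K).
  apply: compact_closed; first exact: manifold_hausdorff.
  apply: continuous_compact => //; apply: continuous_in_subspaceT => x.
  by rewrite inE => /KV/VC; exact: param_continuous_at.
have [[x Kx <-]|Lp] := pselect ((param c @` K) p).
  exists c, V; have cx := VC _ (KV _ Kx); split=> //.
  - exact: param_dom.
  - by rewrite paramK//; exact: KV.
  - apply: (smooth_on_eq oV _ su) => y /VC cy /=.
    by rewrite chart_ext_in ?paramK//; exact: param_dom.
have [d Ad dp] := atlas_cover p.
exists d, (cod d `&` param d @^-1` (~` (param c @` K))); split=> //.
- by apply: open_param_preimage; exact: closed_openC.
- by split; [exact: coord_cod|rewrite /= coordK].
have oW : open (cod d `&` param d @^-1` (~` (param c @` K))).
  by apply: open_param_preimage; exact: closed_openC.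
apply: (smooth_on_eq oW _ (smooth_on_cst 0 oW)) => y [dy Ky] /=.
have [cy|cy] := pselect (dom c (param d y)); last by rewrite chart_ext_out.
rewrite chart_ext_in// u0// => Kcy; apply: Ky.
by exists (coord c (param d y)) => //; rewrite coordK.
Qed.

Lemma smooth_fun_chart c (f : C^oo(M)) : atlas M c ->
  smooth_on (cod c) (f \o param c).
Proof. exact: Cinf_smooth. Qed.

Lemma Cinf_bump p (A : set M) : nbhs p A ->
  exists b : C^oo(M), b p = 1 /\ forall q, ~ A q -> b q = 0.
Proof.
move=> nA; have [c Ac cp] := atlas_cover p.
pose V := cod c `&` param c @^-1` (A^°).
have oV : open V by apply: open_param_preimage; exact: open_interior.
have Vp : V (coord c p) by split; [exact: coord_cod|rewrite /= coordK].
have [rho [K [cK KV srho rho1 rho0]]] := cutoff_exists oV Vp.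
have sb : smooth_fun (chart_ext c rho).
  apply: (chart_ext_smooth (K := K) (V := V)) => //; first by move=> x [].
  exact: smooth_on_sub srho.
exists (mkCinf _ sb); split=> [|q Aq] /=.
  by rewrite chart_ext_in//; exact: nbhs_singleton rho1.
have [cq|cq] := pselect (dom c q); last by rewrite chart_ext_out.
rewrite chart_ext_in// rho0// => /KV[_]; rewrite /= coordK// => Iq.
exact: (Aq (interior_subset Iq)).
Qed.

End Charts.

Section TangentVectors.
Variables (R : realType) (n : nat) (M : manifold R n) (p : M).
Implicit Types (v : tangent p) (f g : C^oo(M)).

Lemma tangentD v f g : v (f + g) = v f + v g.
Proof. by have := tangent_scalar v 1 f g; rewrite scale1r mul1r. Qed.

Lemma tangent0 v : v 0 = 0.
Proof. by apply: (@addrI _ (v 0)); rewrite -tangentD !addr0. Qed.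

Lemma tangentZ v (k : R) f : v (k *: f) = k * v f.
Proof. by rewrite -[k *: f]addr0 tangent_scalar tangent0 addr0. Qed.

Lemma tangentB v f g : v (f - g) = v f - v g.
Proof. by rewrite -scaleN1r tangentD tangentZ mulN1r. Qed.

Lemma tangent_sum v I (s : seq I) (F : I -> C^oo(M)) :
  v (\sum_(i <- s) F i) = \sum_(i <- s) v (F i).
Proof.
by apply: (big_morph (v : C^oo(M) -> R)); [exact: tangentD|exact: tangent0].
Qed.

Lemma tangent1 v : v 1 = 0.
Proof.
have := tangent_leibniz v 1 1; have -> : (1 : C^oo(M)) p = 1 by [].
rewrite !mulr1 mul1r => E.
by apply: (@addrI _ (v 1)); rewrite addr0 {3}E.
Qed.

(** Tangent vectors are derivations of global functions, so locality needs a bump [b] supported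
    where [f] and [g] agree: then b (f - g) = 0, and the Leibniz rule at [p] gives the claim. *)
Lemma tangent_eq_near v f g : (\forall q \near p, f q = g q) -> v f = v g.
Proof.
move=> fg; have [b [bp b0]] := Cinf_bump fg.
have : v (b * (f - g)) = 0.
  rewrite -(tangent0 v); congr (v _); apply: CinfP => q.
  have [E|E] := pselect (f q = g q); last first.
    by rewrite [LHS](_ : _ = b q * (f q - g q))// b0// mul0r.
  by rewrite [LHS](_ : _ = b q * (f q - g q))// E subrr mulr0.
rewrite tangent_leibniz bp mul1r.
have -> : (f - g) p = f p - g p by [].
by rewrite (nbhs_singleton fg) subrr mulr0 add0r tangentB => /subr0_eq.
Qed.

End TangentVectors.

(** * Local frames made of global functions and derivations *)

Section LocalFrame.
Variables (R : realType) (n : nat) (M : manifold R n).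

Definition Cinf_cst (a : R) : C^oo(M) := mkCinf _ (@smooth_fun_cst _ _ M a).

Lemma tangent_cst p (v : tangent p) (a : R) : v (Cinf_cst a) = 0.
Proof.
have -> : Cinf_cst a = a *: (1 : C^oo(M)) by apply: CinfP => q; rewrite /= [RHS]mulr1.
by rewrite tangentZ tangent1 mulr0.
Qed.

Lemma CinfD (f g : C^oo(M)) p : (f + g) p = f p + g p. Proof. by []. Qed.
Lemma CinfN (f : C^oo(M)) p : (- f) p = - f p. Proof. by []. Qed.
Lemma CinfB (f g : C^oo(M)) p : (f - g) p = f p - g p. Proof. by []. Qed.
Lemma CinfM (f g : C^oo(M)) p : (f * g) p = f p * g p. Proof. by []. Qed.
Lemma CinfZ (a : R) (f : C^oo(M)) p : (a *: f) p = a * f p. Proof. by []. Qed.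
Lemma Cinf_sum I (s : seq I) (F : I -> C^oo(M)) p :
  (\sum_(i <- s) F i) p = \sum_(i <- s) F i p.
Proof. by apply: (big_morph (fun f : C^oo(M) => f p)). Qed.

Section Chart.
Variables (c : chart R n M) (rho : 'rV[R]_n -> R) (K : set 'rV[R]_n).
Hypotheses (Ac : atlas M c) (cK : compact K) (Kc : K `<=` cod c).
Hypotheses (srho : smooth_on (cod c) rho) (rho0 : forall x, ~ K x -> rho x = 0).

Lemma cutoff_smooth w : smooth_on (cod c) w ->
  smooth_fun (chart_ext c (fun x => rho x * w x)).
Proof.
move=> sw; apply: (chart_ext_smooth (K := K) (V := cod c)) => //.
- exact: cod_open.
- by apply: (smooth_onM _ srho sw); exact: cod_open.
- by move=> x /rho0 ->; rewrite mul0r.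
Qed.

(** Multiplication by [rho] makes the coordinates of one chart global functions and its partials
    global derivations; they keep their coordinate meaning where [rho] is 1. *)
Definition cutoff_coord i : C^oo(M) :=
  mkCinf _ (cutoff_smooth (smooth_on_coord i (cod_open c))).

Definition cutoff_partial i (f : C^oo(M)) : C^oo(M) :=
  mkCinf _ (cutoff_smooth (smooth_on_partial i (smooth_fun_chart f Ac))).

Lemma cutoff_partial_linear i : linear (cutoff_partial i).
Proof.
move=> a f g; apply: CinfP => p; rewrite CinfD CinfZ /=.
have [cp|cp] := pselect (dom c p); last first.
  by rewrite !chart_ext_out// mulr0 addr0.
rewrite !chart_ext_in//.
set x := coord c p; have cx : cod c x by exact: coord_cod.
have df (h : C^oo(M)) : derivable (h \o param c) x (delta_mx 0 i).
  by apply: diff_derivable; exact: smooth_on_differentiable (smooth_fun_chart h Ac) cx.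
have -> : (a *: f + g) \o param c = a *: (f \o param c) + (g \o param c) :> (_ -> R).
  by [].
rewrite deriveD//; last exact: derivableZ.
by rewrite deriveZ// mulrDr /GRing.scale /= mulrCA.
Qed.

Lemma cutoff_partial_leibniz i f g : cutoff_partial i (f * g) =
  cutoff_partial i f * g + f * cutoff_partial i g.
Proof.
apply: CinfP => p; rewrite CinfD !CinfM /=.
have [cp|cp] := pselect (dom c p); last first.
  by rewrite !chart_ext_out// mul0r mulr0 addr0.
rewrite !chart_ext_in//.
set x := coord c p; have cx : cod c x by exact: coord_cod.
have df (h : C^oo(M)) : derivable (h \o param c) x (delta_mx 0 i).
  by apply: diff_derivable; exact: smooth_on_differentiable (smooth_fun_chart h Ac) cx.
have -> : (f * g) \o param c = (f \o param c) * (g \o param c) :> (_ -> R) by [].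
rewrite deriveM// /GRing.scale /= /x coordK//; ring.
Qed.

(* By Hadamard's lemma, [b^2 (f - f q) = \sum_i b (X_i - X_i q) * (b g_i)]    *)
(* for a bump function [b] at [q] and smooth [g_i] with [g_i q = D_i f q].    *)
Lemma tangent_cutoff_coord q (v : tangent q) f : dom c q ->
  (\forall x \near coord c q, rho x = 1) ->
  v f = \sum_i cutoff_partial i f q * v (cutoff_coord i).
Proof.
move=> cq rho1; pose a := coord c q.
have ca : cod c a by exact: coord_cod.
have [r /= r0 rV] : exists2 r : R, 0 < r & forall x, ball a r x -> cod c x /\ rho x = 1.
  have : \forall x \near a, cod c x /\ rho x = 1.
    by apply: filterI => //; exact: open_nbhs_nbhs (conj (cod_open c) ca).
  by move=> /nbhs_ballP[r r0 rV]; exists r.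
have sf : smooth_on (ball a r) (f \o param c).
  by apply: smooth_on_sub (smooth_fun_chart f Ac) => x /rV[].
have [g [sg ga fE]] := hadamard sf.
have [b [L [cL LV sb b1 b0]]] := cutoff_exists (@ball_open _ _ a r) (ballxx a r0).
have rc : ball a r `<=` cod c by move=> x /rV[].
have sB : smooth_fun (chart_ext c b).
  apply: (chart_ext_smooth (K := L) (V := ball a r)) => //; first exact: ball_open.
  exact: smooth_on_sub sb.
have sG i : smooth_fun (chart_ext c (fun x => b x * g i x)).
  apply: (chart_ext_smooth (K := L) (V := ball a r)) => //; first exact: ball_open.
    apply: smooth_onM (sg i); [exact: ball_open|exact: smooth_on_sub sb].
  by move=> x /b0 ->; rewrite mul0r.
pose B := mkCinf _ sB; pose G i := mkCinf _ (sG i).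
have bq : B q = 1 by rewrite /= chart_ext_in//; exact: nbhs_singleton b1.
have E : B * B * (f - Cinf_cst (f q)) =
    \sum_i B * (cutoff_coord i - Cinf_cst (a 0 i)) * G i.
  apply: CinfP => p; rewrite Cinf_sum !CinfM CinfB.
  have [cp|cp] := pselect (dom c p); last first.
    have -> : B p = 0 by rewrite /= chart_ext_out.
    rewrite !mul0r big1// => i _; rewrite !CinfM.
    have -> : B p = 0 by rewrite /= chart_ext_out.
    by rewrite !mul0r.
  have [xr|xr] := pselect (ball a r (coord c p)); last first.
    have B0 : B p = 0.
      by rewrite /= chart_ext_in// b0// => /LV.
    by rewrite B0 !mul0r big1// => i _; rewrite !CinfM B0 !mul0r.
  have fp : f p = f q + \sum_i (coord c p 0 i - a 0 i) * g i (coord c p).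
    by have := fE _ xr; rewrite /= !coordK.
  rewrite [Cinf_cst _ p]/= fp [_ - _]addrAC subrr add0r mulr_sumr; apply: eq_bigr => i _.
  rewrite !CinfM CinfB /= !chart_ext_in// (rV _ xr).2 mul1r /a; ring.
have vB : v (B * B * (f - Cinf_cst (f q))) = v f.
  rewrite tangent_leibniz CinfB [Cinf_cst _ q]/= subrr mulr0 add0r CinfM bq !mul1r.
  by rewrite tangentB tangent_cst subr0.
rewrite -vB E tangent_sum; apply: eq_bigr => i _.
have Xq : cutoff_coord i q = a 0 i.
  by rewrite /= chart_ext_in// (nbhs_singleton rho1) mul1r.
rewrite tangent_leibniz CinfM CinfB Xq [Cinf_cst _ q]/= subrr mulr0 mul0r addr0.
rewrite tangent_leibniz CinfB Xq [Cinf_cst _ q]/= subrr mulr0 add0r bq mul1r.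
rewrite tangentB tangent_cst subr0 mulrC; congr (_ * _).
rewrite /= !chart_ext_in// (nbhs_singleton rho1) (nbhs_singleton b1) !mul1r.
exact: ga.
Qed.

End Chart.

(** A single frame serves all points near [p]: the value at [p] suffices for covectors, but
    decomposing a bisection needs a neighbourhood. *)
Lemma local_frame (p : M) :
  exists (X : 'I_n -> C^oo(M)) (D : 'I_n -> C^oo(M) -> C^oo(M)),
    [/\ forall i, linear (D i),
        forall i f g, D i (f * g) = D i f * g + f * D i g &
        \forall q \near p, forall (v : tangent q) f,
          v f = \sum_i D i f q * v (X i)].
Proof.
have [c Ac cp] := atlas_cover p.
have [rho [K [cK KV srho rho1 rho0]]] :=
  cutoff_exists (cod_open c) (coord_cod cp).
have sc : smooth_on (cod c) rho by exact: smooth_on_sub srho.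
exists (cutoff_coord Ac cK KV sc rho0), (cutoff_partial Ac cK KV sc rho0); split.
- exact: cutoff_partial_linear.
- exact: cutoff_partial_leibniz.
(* [tangent_cutoff_coord] needs [rho] to be 1 around the coordinates of [q], hence the interior. *)
have oN : open (interior [set x | rho x = 1]) by exact: open_interior.
have nN := open_coord_preimage c oN.
near=> q => v f.
have [cq qN] : (dom c `&` coord c @^-1` (interior [set x | rho x = 1])) q.
  by near: q; apply: open_nbhs_nbhs; split.
exact: tangent_cutoff_coord.
Unshelve. all: by end_near. Qed.

End LocalFrame.

(** * The Hom-Schouten bracket and the Jacobiator *)

Lemma ord2_cases (k : 'I_2) : k = 0 \/ k = 1.
Proof. by case: k => -[|[|//]] lt2; [left|right]; exact: val_inj. Qed.

Lemma det_mx22 (R : comPzRingType) (A : 'M[R]_2) :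
  \det A = A 0 0 * A 1 1 - A 0 1 * A 1 0.
Proof.
rewrite (expand_det_row A 0) !big_ord_recl big_ord0 addr0 /cofactor !det_mx11 !mxE.
have l0 : lift 0 0 = 1 :> 'I_2 by exact/val_inj.
have l1 : lift 1 0 = 0 :> 'I_2 by exact/val_inj.
by rewrite /= !l0 l1 addn0 addn1 expr0 expr1 mul1r mulN1r mulrN.
Qed.

Lemma det_mx33 (R : comPzRingType) (A : 'M[R]_3) :
  \det A = A 0 0 * (A 1 1 * A 2 2 - A 1 2 * A 2 1)
         - A 0 1 * (A 1 0 * A 2 2 - A 1 2 * A 2 0)
         + A 0 2 * (A 1 0 * A 2 1 - A 1 1 * A 2 0).
Proof.
rewrite (expand_det_row A 0) !big_ord_recl big_ord0 addr0 /cofactor !det_mx22 !mxE.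
have l00 : lift 0 0 = 1 :> 'I_3 by exact/val_inj.
have l01 : lift 0 1 = 2 :> 'I_3 by exact/val_inj.
have l10 : lift 1 0 = 0 :> 'I_3 by exact/val_inj.
have l11 : lift 1 1 = 2 :> 'I_3 by exact/val_inj.
have l20 : lift 2 0 = 0 :> 'I_3 by exact/val_inj.
have l21 : lift 2 1 = 1 :> 'I_3 by exact/val_inj.
have l0 : lift 0 0 = 1 :> 'I_2 by exact/val_inj.
rewrite !(l0, l00, l01, l10, l11, l20, l21) /=.
rewrite addn0 addn1 addn2 expr0 expr1 sqrrN expr1n !mul1r mulN1r mulrN.
by rewrite addrA.
Qed.

Section SchoutenJacobiator.
Variables (R : realType) (n : nat) (M : manifold R n) (phi : diffeo M).
Implicit Types (x y : 'I_2 -> vsection phi) (f g h : C^oo(M)).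

(* With c the pullback by phi, [vder x] is the ordinary derivation x o c^-1;  *)
(* Ad x is c o vder x and the Hom-bracket is c o [vder x, vder y].            *)
Definition vder (x : vsection phi) f : C^oo(M) :=
  vsection_app x (pullbackV phi f).

Lemma vderM (x : vsection phi) f g :
  vder x (f * g) = vder x f * g + f * vder x g.
Proof. by rewrite /vder pullbackVM (vsection_app_derivation x).2 !pullbackVK. Qed.

Lemma vderB (x : vsection phi) f g : vder x (f - g) = vder x f - vder x g.
Proof.
apply: CinfP => q; rewrite CinfB /= -tangentB; congr (x q _); exact: CinfP.
Qed.

Definition bivector_app x f g : C^oo(M) :=
  vder (x 0) f * vder (x 1) g - vder (x 1) f * vder (x 0) g.

Lemma wedge2E x f g m :
  wedge x m (tnth [tuple hom_d phi f m; hom_d phi g m]) =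
  x 0 m f * x 1 m g - x 1 m f * x 0 m g.
Proof. by rewrite /= det_mx22 !mxE /= mulrC [X in _ - X]mulrC. Qed.

(** The symmetric polarisation in the bivector of P |-> P(P(f, g), h). *)
Definition schouten_app x y f g h : C^oo(M) :=
  bivector_app x (bivector_app y f g) h + bivector_app y (bivector_app x f g) h.

Lemma hom_schouten_family0 x y (i j : 'I_2) :
  hom_schouten_family (p := 1) (q := 1) x y i j 0 = hom_bracket (x i) (y j).
Proof. by rewrite /hom_schouten_family unlift_none. Qed.

Lemma hom_schouten_family1 x y (i j : 'I_2) :
  hom_schouten_family (p := 1) (q := 1) x y i j 1 = Ad (x (lift i ord0)).
Proof.
have -> : 1 = lift ord0 (unsplit (inl ord0 : 'I_1 + 'I_1)%type) :> 'I_3.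
  exact/val_inj.
by rewrite /hom_schouten_family liftK unsplitK.
Qed.

Lemma hom_schouten_family2 x y (i j : 'I_2) :
  hom_schouten_family (p := 1) (q := 1) x y i j 2 = Ad (y (lift j ord0)).
Proof.
have -> : 2 = lift ord0 (unsplit (inr ord0 : 'I_1 + 'I_1)%type) :> 'I_3.
  exact/val_inj.
by rewrite /hom_schouten_family liftK unsplitK.
Qed.

Lemma Ad_app (x : vsection phi) f m : Ad x m f = vder x f (phi m).
Proof. by []. Qed.

Lemma hom_bracket_app (x y : vsection phi) f m :
  hom_bracket x y m f =
  vder x (vder y f) (phi m) - vder y (vder x f) (phi m).
Proof. by []. Qed.

(** Expand the 3 by 3 determinants on one side and the Leibniz rule on the other. In the cyclic sum
    the second-order terms combine into the commutators of [vder (x i)] and [vder (y j)]. *)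
Lemma hom_schouten_decE x y m (F : 'I_3 -> C^oo(M)) :
  hom_schouten_dec x y m (fun i => hom_d phi (F i) m) =
  - (schouten_app x y (F 0) (F 1) (F 2) +
     schouten_app x y (F 1) (F 2) (F 0) +
     schouten_app x y (F 2) (F 0) (F 1)) (phi m).
Proof.
have sumE (P : 'I_2 -> 'I_2 -> ext 3 (tangent (phi m))) u :
    (\sum_i \sum_j P i j) u = P 0 0 u + P 0 1 u + (P 1 0 u + P 1 1 u).
  have l1 : lift ord0 ord0 = 1 :> 'I_2 by exact/val_inj.
  by rewrite !big_ord_recl !big_ord0 !addr0 !l1.
rewrite /hom_schouten_dec sumE.
have dE (i j : 'I_2) a : (a *: wedge (hom_schouten_family (p := 1) (q := 1) x y i j) m)
    (fun i => hom_d phi (F i) m) =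
  a * \det (\matrix_(k, l) hom_schouten_family (p := 1) (q := 1) x y i j l m (F k)).
  by [].
rewrite !dE !det_mx33 !mxE.
rewrite !hom_schouten_family0 !hom_schouten_family1 !hom_schouten_family2.
have l0 : lift 0 ord0 = 1 :> 'I_2 by exact/val_inj.
have l1 : lift 1 ord0 = 0 :> 'I_2 by exact/val_inj.
rewrite !l0 !l1 !Ad_app !hom_bracket_app.
rewrite /schouten_app /bivector_app !vderB !vderM.
rewrite !(CinfD, CinfN, CinfM).
have s00 : (-1) ^+ ((0%R : 'I_2) + (0%R : 'I_2)) = 1 :> R by [].
have s01 : (-1) ^+ ((0%R : 'I_2) + (1%R : 'I_2)) = -1 :> R by [].
have s10 : (-1) ^+ ((1%R : 'I_2) + (0%R : 'I_2)) = -1 :> R by [].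
have s11 : (-1) ^+ ((1%R : 'I_2) + (1%R : 'I_2)) = 1 :> R by rewrite /= sqrrN expr1n.
rewrite ?s00 ?s01 ?s10 ?s11.
ring.
Qed.

End SchoutenJacobiator.

(** * From wedges to local sums of wedges *)

Section LocalExpressions.
Variables (R : realType) (n : nat) (M : manifold R n) (phi : diffeo M).
Implicit Types (x y : 'I_2 -> vsection phi) (f g h F G : C^oo(M)).
Implicit Types (pi : msection phi 2) (a m : M).

Lemma ext_sum k (V : lmodType R) I (s : seq I) (E : I -> ext k V) u :
  (\sum_(i <- s) E i) u = \sum_(i <- s) E i u.
Proof. by apply: (big_morph (fun P : ext k V => P u)). Qed.

Lemma vder_eq_near (x : vsection phi) F G a :
  (\forall q \near a, F q = G q) -> vder x F a = vder x G a.
Proof.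
move=> FG; apply: tangent_eq_near.
have cV : {for phi a, continuous (diffeo_inv phi)}.
  exact: (diffeo_inv_smooth phi).1.
move: cV; rewrite /prop_for /continuous_at diffeoK => cV.
exact: (cV _ FG).
Qed.

Lemma vder_sum (x : vsection phi) I (s : seq I) (F : I -> C^oo(M)) a :
  vder x (\sum_(i <- s) F i) a = \sum_(i <- s) vder x (F i) a.
Proof.
rewrite /= -tangent_sum; congr (x a _); apply: CinfP => q.
by rewrite /= !Cinf_sum.
Qed.

Lemma bivector_appE x f g a : bivector_app x f g a =
  vder (x 0) f a * vder (x 1) g a - vder (x 1) f a * vder (x 0) g a.
Proof. by []. Qed.

Definition twisted_bracket pi f g : C^oo(M) :=
  poisson_bracket pi (pullbackV phi f) (pullbackV phi g).

Lemma twisted_bracketE pi a s f g : locally_sum_of_wedges pi a s ->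
  \forall q \near a, \sum_(x <- s) bivector_app x f g q = twisted_bracket pi f g q.
Proof.
apply: filterS => q piq; rewrite /twisted_bracket poisson_bracketE piq ext_sum.
by apply: eq_bigr => x _; rewrite wedge2E.
Qed.

(** The outer bivector is used only at [a], but the inner one is differentiated there, so its
    decomposition must hold on a neighbourhood. *)
Lemma sum_bivector_app2 pi a s t f g h :
  locally_sum_of_wedges pi a s -> locally_sum_of_wedges pi a t ->
  \sum_(x <- s) \sum_(y <- t) bivector_app x (bivector_app y f g) h a =
  twisted_bracket pi (twisted_bracket pi f g) h a.
Proof.
move=> sa ta; rewrite -(nbhs_singleton (twisted_bracketE _ _ sa)).
apply: eq_bigr => x _; rewrite bivector_appE.
have E (z : vsection phi) : vder z (twisted_bracket pi f g) a =
    \sum_(y <- t) vder z (bivector_app y f g) a.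
  rewrite -vder_sum; apply: vder_eq_near.
  by apply: filterS (twisted_bracketE f g ta) => q <-; rewrite Cinf_sum.
by rewrite !E !mulr_suml -sumrB.
Qed.

(** The decompositions [s] and [t] are independent, so this also shows that the value depends only
    on [pi]. The 2 comes from the two halves of [schouten_app], which contribute equally. *)
Lemma sum_hom_schouten_decE pi m s t (F : 'I_3 -> C^oo(M)) :
  let P := twisted_bracket pi in
  locally_sum_of_wedges pi (phi m) s -> locally_sum_of_wedges pi (phi m) t ->
  (\sum_(x <- s) \sum_(y <- t) hom_schouten_dec (p := 1) (q := 1) x y m)
    (fun i => hom_d phi (F i) m) =
  - 2 * (P (P (F 0) (F 1)) (F 2) + P (P (F 1) (F 2)) (F 0) +
         P (P (F 2) (F 0)) (F 1)) (phi m).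
Proof.
move=> P sa ta; rewrite ext_sum.
transitivity (- \sum_(x <- s) \sum_(y <- t)
  (schouten_app x y (F 0) (F 1) (F 2) (phi m) +
   schouten_app x y (F 1) (F 2) (F 0) (phi m) +
   schouten_app x y (F 2) (F 0) (F 1) (phi m))).
  rewrite -sumrN; apply: eq_bigr => x _; rewrite ext_sum -sumrN.
  by apply: eq_bigr => y _; exact: hom_schouten_decE.
have E f g h : \sum_(x <- s) \sum_(y <- t) schouten_app x y f g h (phi m) =
    2 * P (P f g) h (phi m).
  rewrite mulr2n mulrDl !mul1r -[in X in X + _](sum_bivector_app2 f g h sa ta).
  rewrite -(sum_bivector_app2 f g h ta sa) [X in _ = _ + X]exchange_big -big_split.
  by apply: eq_bigr => x _; rewrite -big_split.
have D3 (A B C : ('I_2 -> vsection phi) -> ('I_2 -> vsection phi) -> R) :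
    \sum_(x <- s) \sum_(y <- t) (A x y + B x y + C x y) =
    \sum_(x <- s) \sum_(y <- t) A x y + \sum_(x <- s) \sum_(y <- t) B x y +
    \sum_(x <- s) \sum_(y <- t) C x y.
  rewrite -!big_split; apply: eq_bigr => x _; by rewrite -!big_split.
rewrite (D3 (fun x y => schouten_app x y (F 0) (F 1) (F 2) (phi m))) !E !CinfD; ring.
Qed.

End LocalExpressions.

(** * Differentials exhaust the cotangent spaces *)

Section Differentials.
Variables (R : realType) (n : nat) (M : manifold R n).

Lemma tangentP (q : M) (v w : tangent q) : (forall f, v f = w f) -> v = w.
Proof. by move=> vw; apply/val_inj/funext. Qed.

Lemma sum_tangentE (q : M) I (s : seq I) (w : I -> tangent q) f :
  (\sum_(i <- s) w i) f = \sum_(i <- s) w i f.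
Proof. by apply: (big_morph (fun v : tangent q => v f)). Qed.

(** The frame derivations at [q] are tangent vectors e_i with v = sum_i v(X_i) e_i, so [u] is the
    differential of sum_i u(e_i) X_i. *)
Lemma dual_differential (q : M) (u : dual (tangent q)) :
  exists f, differential q f = u.
Proof.
have [X [D [lD dD nE]]] := local_frame q.
have vE (v : tangent q) f : v f = \sum_i D i f q * v (X i) := nbhs_singleton nE v f.
have Dscalar i : scalar (fun f => D i f q) by move=> a f g; rewrite lD.
have Dleibniz i f g : D i (f * g) q = D i f q * g q + f q * D i g q.
  by rewrite dD.
pose e i : tangent q := mktangent (Dscalar i) (Dleibniz i).
have e_span (v : tangent q) : v = \sum_i v (X i) *: e i.
  apply: tangentP => f; rewrite vE sum_tangentE.
  by apply: eq_bigr => i _; rewrite /= mulrC.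
have uD : {morph (u : _ -> R) : w z / w + z}.
  by move=> w z; have := dual_scalar u 1 w z; rewrite scale1r mul1r.
have u0 : u 0 = 0 by apply: (@addrI _ (u 0)); rewrite -uD !addr0.
have uZ a w : u (a *: w) = a * u w.
  by have := dual_scalar u a w 0; rewrite u0 !addr0.
exists (\sum_i u (e i) *: X i); apply/val_inj/funext => v.
rewrite /= tangent_sum [in RHS](e_span v) (big_morph (u : _ -> R) uD u0).
by apply: eq_bigr => i _; rewrite uZ tangentZ mulrC.
Qed.

Lemma ext_eq_differentials k (q : M) (P Q : ext k (tangent q)) :
  (forall f : 'I_k -> C^oo(M), P (fun i => differential q (f i)) =
                               Q (fun i => differential q (f i))) -> P = Q.
Proof.
move=> PQ; apply/val_inj/funext => u.
have [f fE] := choice (fun i => dual_differential (u i)).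
by have := PQ f; rewrite (_ : (fun i => _) = u)//; apply/funext => i.
Qed.

End Differentials.

Section BilinearAlternating.
Variables (R : realType) (V : lmodType R) (P : ext 2 V).
Implicit Types u v w : dual V.

Local Notation B u v := (P (tnth [tuple u; v])).

Lemma ext2_tuple (u : 'I_2 -> dual V) : P u = B (u 0) (u 1).
Proof.
congr (P _); apply/funext => -[[|[|//]] i2].
- by rewrite (tnth_nth (u 0)) /=; congr u; exact: val_inj.
- by rewrite (tnth_nth (u 0)) /=; congr u; exact: val_inj.
Qed.

Lemma ext2_linear_l a u v w : B (a *: u + v) w = a * B u w + B v w.
Proof.
apply: (@ext_multilinear _ _ _ P 0); rewrite ?(tnth_nth u)//.
by move=> [[|[|//]] i2] //= _; rewrite !(tnth_nth u).
Qed.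

Lemma ext2_linear_r a u v w : B w (a *: u + v) = a * B w u + B w v.
Proof.
apply: (@ext_multilinear _ _ _ P 1); rewrite ?(tnth_nth u)//.
by move=> [[|[|//]] i2] //= _; rewrite !(tnth_nth u).
Qed.

Lemma ext2_0r w : B w 0 = 0.
Proof.
have := ext2_linear_r 1 0 0 w; rewrite scaler0 addr0 mul1r => E.
by apply: (@addrI _ (B w 0)); rewrite -E addr0.
Qed.

Lemma ext2_skew u v : B u v = - B v u.
Proof.
have Bxx w : B w w = 0.
  by apply: (@ext_alternating _ _ _ P _ 0 1) => //; rewrite !(tnth_nth w).
have := Bxx (1 *: u + v); rewrite ext2_linear_l !ext2_linear_r !Bxx !mul1r.
by rewrite add0r addr0 => /eqP; rewrite addr_eq0 => /eqP.
Qed.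

End BilinearAlternating.

(** * Hom-Poisson tensors and brackets *)

Section PoissonBracket.
Variables (R : realType) (n : nat) (M : manifold R n) (phi : diffeo M).
Implicit Types (f g h : C^oo(M)) (m : M).

Lemma hom_d_linear a f g m :
  hom_d phi (a *: f + g) m = a *: hom_d phi f m + hom_d phi g m.
Proof. by apply/val_inj/funext => v; rewrite /= tangent_scalar. Qed.

Lemma hom_dM f g m : hom_d phi (f * g) m =
  g (phi m) *: hom_d phi f m + f (phi m) *: hom_d phi g m.
Proof. by apply/val_inj/funext => v; rewrite /= tangent_leibniz mulrC. Qed.

Lemma msection2P (pi pi' : msection phi 2) :
  (forall f g, poisson_bracket pi f g = poisson_bracket pi' f g) -> pi = pi'.
Proof.
move=> E; apply: msectionP => m; apply: ext_eq_differentials => f.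
rewrite ext2_tuple [RHS]ext2_tuple.
by have := congr1 (fun F : C^oo(M) => F m) (E (f 0) (f 1)); rewrite !poisson_bracketE.
Qed.

Section FixedTensor.
Variable pi : msection phi 2.
Local Notation "{{ f , g }}" := (poisson_bracket pi f g) (format "{{ f ,  g }}").

Lemma poisson_bracket_bilinear : bilinear_op (poisson_bracket pi).
Proof.
split=> [f a g h|f a g h]; apply: CinfP => m; rewrite CinfD CinfZ !poisson_bracketE.
  by rewrite hom_d_linear ext2_linear_r.
by rewrite hom_d_linear ext2_linear_l.
Qed.

Lemma poisson_bracket_skew f g : {{f, g}} = - {{g, f}}.
Proof.
by apply: CinfP => m; rewrite CinfN !poisson_bracketE ext2_skew.
Qed.

Lemma poisson_bracket_leibniz f g h :
  {{f, g * h}} = pullback phi g * {{f, h}} + {{f, g}} * pullback phi h.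
Proof.
apply: CinfP => m; rewrite CinfD !CinfM !poisson_bracketE hom_dM.
rewrite ext2_linear_r -[_ *: hom_d phi h m]addr0 ext2_linear_r.
by rewrite ext2_0r addr0 /= addrC; congr (_ + _); rewrite mulrC.
Qed.

(** At [m], g |-> {f, g} is a tangent vector at [phi m], so the frame formula applies; skew-symmetry
    then treats the other argument. *)
Lemma poisson_bracket_expand (X : 'I_n -> C^oo(M)) (D : 'I_n -> C^oo(M) -> C^oo(M)) m :
  (forall (v : tangent (phi m)) f, v f = \sum_i D i f (phi m) * v (X i)) ->
  forall f g, {{f, g}} m =
    \sum_i \sum_j D i f (phi m) * D j g (phi m) * {{X i, X j}} m.
Proof.
move=> DX; have [_ lr] := poisson_bracket_bilinear.
have expand f g : {{f, g}} m = \sum_j D j g (phi m) * {{f, X j}} m.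
  have [lf _] := poisson_bracket_bilinear.
  have sf : scalar (fun g => {{f, g}} m) by move=> a g1 g2; rewrite lf.
  have df g1 g2 : {{f, g1 * g2}} m =
      {{f, g1}} m * g2 (phi m) + g1 (phi m) * {{f, g2}} m.
    by rewrite poisson_bracket_leibniz CinfD !CinfM addrC.
  exact: (DX (mktangent sf df) g).
move=> f g; rewrite expand exchange_big; apply: eq_bigr => j _.
rewrite poisson_bracket_skew CinfN expand -sumrN mulr_sumr.
apply: eq_bigr => i _; rewrite [in RHS]poisson_bracket_skew CinfN; ring.
Qed.

(** Near [a], [pi] is half the sum over all i, j of {X_i, X_j} E_i /\ E_j, where E_i is D_i followed
    by the pullback. *)
Lemma poisson_tensor_local_wedges a : exists s, locally_sum_of_wedges pi a s.
Proof.
have [X [D [lD dD nE]]] := local_frame (phi a).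
(* The factor 1/2 compensates for summing over ordered pairs. *)
pose c (ij : 'I_n * 'I_n) := 2^-1 *: {{X ij.1, X ij.2}}.
(* The coefficient [k] is absorbed into a section, since the wedges are summed without
   coefficients. *)
have hE (k : C^oo(M)) j : pullback_derivation phi (fun f => k * pullback phi (D j f)).
  have pE h m : pullback phi h m = h (phi m) by [].
  split=> [b f g|f g]; apply: CinfP => m.
    by rewrite lD !(CinfM, CinfD, CinfZ, pE); ring.
  by rewrite dD !(CinfM, CinfD, pE); ring.
pose E k j := vsection_of (hE k j).
exists [seq tnth [tuple E (c ij) ij.1; E 1 ij.2] | ij <- index_enum ('I_n * 'I_n)%type].
have cphi : {for a, continuous phi} by exact: (diffeo_smooth phi).1.
have nE' : \forall m \near a, forall (v : tangent (phi m)) f,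
    v f = \sum_i D i f (phi m) * v (X i) := cphi _ nE.
apply: filterS nE' => m DX.
apply: ext_eq_differentials => f; rewrite big_map ext_sum ext2_tuple.
rewrite -[LHS]poisson_bracketE (poisson_bracket_expand DX).
pose d i j := D i (f 0) (phi m) * D j (f 1) (phi m).
pose b i j := {{X i, X j}} m.
have b_skew i j : b i j = - b j i by rewrite /b poisson_bracket_skew.
transitivity (\sum_i \sum_j 2^-1 * b i j * (d i j - d j i)).
  transitivity (2^-1 * \sum_i \sum_j d i j * b i j +
                2^-1 * \sum_i \sum_j d j i * b j i).
    rewrite [X in _ + _ * X]exchange_big -mulrDl -[2^-1]div1r -splitr mul1r.
    by [].
  rewrite !mulr_sumr -big_split; apply: eq_bigr => i _.
  rewrite !mulr_sumr -big_split; apply: eq_bigr => j _.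
  by rewrite (b_skew j i) /=; ring.
rewrite pair_bigA; apply: eq_bigr => -[i j] _.
rewrite [RHS]ext2_tuple wedge2E.
have EE k l h : E k l m h = k m * D l h (phi m) by [].
have oneE : (1 : C^oo(M)) m = 1 by [].
have t0 (u v : vsection phi) : tnth [tuple u; v] 0 = u by [].
have t1 (u v : vsection phi) : tnth [tuple u; v] 1 = v by [].
rewrite t0 t1 !EE oneE CinfZ /d /b; ring.
Qed.

(** The bracket of [Ad_msection pi] on pulled-back functions is the pullback of the bracket of [pi],
    and every function is a pullback. *)
Lemma poisson_tensor_Ad : Ad_msection pi = pi <->
  forall f g, pullback phi {{f, g}} = {{pullback phi f, pullback phi g}}.
Proof.
have AdE f g : poisson_bracket (Ad_msection pi) (pullback phi f) (pullback phi g) =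
    pullback phi {{f, g}}.
  apply: CinfP => m; transitivity ({{f, g}} (phi m)) => //.
  rewrite !poisson_bracketE /=; congr (pi _ _); apply/funext => i.
  by apply/val_inj/funext => v; case: i => -[|[|//]] lti /=; rewrite pullbackK.
split=> [E f g|E]; first by rewrite -AdE E.
apply: msection2P => f g; rewrite -(pullbackVK phi f) -(pullbackVK phi g).
by rewrite AdE E.
Qed.

(** In the nested twisted bracket [f] and [g] carry the inverse pullback twice and [h] once, so two
    pullbacks leave one on [h]. *)
Lemma pullbackV_twisted : Ad_msection pi = pi -> forall f g h,
  pullback phi (pullback phi
    (twisted_bracket pi (twisted_bracket pi f g) h)) =
  - {{pullback phi h, {{f, g}}}}.
Proof.
move=> /poisson_tensor_Ad E f g h.
by rewrite /twisted_bracket !(E, pullbackVK) -poisson_bracket_skew.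
Qed.

Lemma hom_schouten_jacobi : Ad_msection pi = pi ->
  (is_hom_schouten (p := 1) (q := 1) pi pi (msection0 phi 3) <->
   forall f g h, {{pullback phi f, {{g, h}}}} + {{pullback phi g, {{h, f}}}} +
                 {{pullback phi h, {{f, g}}}} = 0).
Proof.
move=> AdE; pose P := twisted_bracket pi.
have pD F G : pullback phi (F + G) = pullback phi F + pullback phi G by exact: CinfP.
have jac f g h :
    pullback phi (pullback phi (P (P f g) h + P (P g h) f + P (P h f) g)) =
    - ({{pullback phi f, {{g, h}}}} + {{pullback phi g, {{h, f}}}} +
       {{pullback phi h, {{f, g}}}}).
  by rewrite !pD !pullbackV_twisted//; ring.
split=> [hS f g h|J m].
  apply: oppr_inj; rewrite oppr0 -jac; apply: CinfP => m.
  (* Two pullbacks evaluated at [m] give the value at phi (phi m), which the Hom-Schouten bracket at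
     [phi m] computes. *)
  have [[s Hs] _ /(_ s s Hs Hs) S0] := hS (phi m).
  pose F : 'I_3 -> C^oo(M) := tnth [tuple f; g; h].
  have := sum_hom_schouten_decE F Hs Hs; rewrite /= -S0 => /esym/eqP.
  rewrite mulf_eq0 oppr_eq0 pnatr_eq0 /= => /eqP.
  by rewrite /F !(tnth_nth f).
have [s Hs] := poisson_tensor_local_wedges (phi m).
split; [by exists s|by exists s|move=> s1 s2 H1 H2].
apply: ext_eq_differentials => F; rewrite [RHS](sum_hom_schouten_decE F H1 H2).
have J0 := J (F 0) (F 1) (F 2).
have -> : P (P (F 0) (F 1)) (F 2) + P (P (F 1) (F 2)) (F 0) + P (P (F 2) (F 0)) (F 1) = 0.
  apply: (can_inj (@pullbackK _ _ _ phi)); apply: (can_inj (@pullbackK _ _ _ phi)).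
  rewrite jac J0 oppr0.
  by apply: CinfP.
by rewrite mulr0.
Qed.

End FixedTensor.
End PoissonBracket.

(** * The bisection defined by a purely Hom-Poisson bracket *)

Section TensorOfBracket.
Variables (R : realType) (n : nat) (M : manifold R n) (phi : diffeo M).
Variable br : C^oo(M) -> C^oo(M) -> C^oo(M).
Hypothesis hbr : purely_hom_poisson_algebra
  (fun f g : C^oo(M) => f * g) br (pullback phi).

Let br_skew f g : br f g = - br g f.
Proof. exact: (hom_lie_skew (hom_poisson_lie hbr)). Qed.

Let br_scalar m f : scalar (fun g => br f g m).
Proof. by move=> a g h; rewrite (hom_lie_bilinear (hom_poisson_lie hbr)).1. Qed.

Let br_leibniz m f g h :
  br f (g * h) m = br f g m * h (phi m) + g (phi m) * br f h m.
Proof. by rewrite (hom_poisson_leibniz hbr) CinfD !CinfM addrC. Qed.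

Lemma bracket_differential m f f' g g' :
  hom_d phi f m = hom_d phi f' m -> hom_d phi g m = hom_d phi g' m ->
  br f g m = br f' g' m.
Proof.
have dE h k k' : hom_d phi k m = hom_d phi k' m -> br h k m = br h k' m.
  pose v := mktangent (@br_scalar m h) (br_leibniz m h).
  by move=> /(congr1 (fun u : dual _ => u v)).
by move=> ff' /(dE f) ->; rewrite br_skew CinfN (dE _ _ _ ff') -CinfN -br_skew.
Qed.

Lemma tensor_of_bracket :
  exists pi : msection phi 2, forall f g, br f g = poisson_bracket pi f g.
Proof.
(* A function with prescribed differential is chosen for each covector; by [bracket_differential]
   the choice does not affect the bracket at [m]. *)
have [sel selE] : exists sel : forall m, dual (tangent (phi m)) -> C^oo(M),
    forall m u, hom_d phi (sel m u) m = u.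
  have H m : exists s : dual (tangent (phi m)) -> C^oo(M),
      forall u, hom_d phi (s u) m = u.
    by have [s sE] := choice (@dual_differential _ _ _ (phi m)); exists s.
  exists (fun m => sval (cid (H m))) => m; exact: (svalP (cid (H m))).
pose P m (u : 'I_2 -> dual (tangent (phi m))) := br (sel m (u 0)) (sel m (u 1)) m.
have br_eq m f f' g g' : hom_d phi f m = hom_d phi f' m ->
    hom_d phi g m = hom_d phi g' m -> br f g m = br f' g' m.
  exact: bracket_differential.
have Pext m : P m \in @ext_pred R 2 (tangent (phi m)).
  rewrite inE /=; split=> [i a u v w ui uj|u i j ij uij]; last first.
    have u01 : u 0 = u 1.
      move: ij uij; case: (ord2_cases i) (ord2_cases j) => -> [] ->;
        by rewrite ?eqxx// => _ ->.
    rewrite /P u01; set f := sel m (u 1).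
    have := congr1 (fun F : C^oo(M) => F m) (br_skew f f); rewrite CinfN => /eqP.
    by rewrite -addr_eq0 -mulr2n mulrn_eq0 => /eqP.
  (* [sel m] need not be linear, but it is so after taking differentials at [m], which is all that
     the bracket sees. *)
  have dsel (u1 u2 : dual (tangent (phi m))) :
      hom_d phi (sel m (a *: u1 + u2)) m = hom_d phi (a *: sel m u1 + sel m u2) m.
    by rewrite hom_d_linear !selE.
  rewrite /P; case: (ord2_cases i) ui uj => -> ui uj.
    have [uv uw] := uj 1 isT; rewrite -uv -uw ui.
    rewrite (br_eq _ _ _ _ _ (dsel _ _) (erefl _)).
    by rewrite (hom_lie_bilinear (hom_poisson_lie hbr)).2.
  have [uv uw] := uj 0 isT; rewrite -uv -uw ui.
  rewrite (br_eq _ _ _ _ _ (erefl _) (dsel _ _)).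
  by rewrite (hom_lie_bilinear (hom_poisson_lie hbr)).1.
pose pi_at m : ext 2 (tangent (phi m)) := Ext (Pext m).
have piE f g m : pi_at m (tnth [tuple hom_d phi f m; hom_d phi g m]) = br f g m.
  by apply: br_eq; rewrite selE.
have pi_smooth (f : 'I_2 -> C^oo(M)) :
    smooth_fun (fun m => pi_at m (fun i => hom_d phi (f i) m)).
  have -> : (fun m => pi_at m (fun i => hom_d phi (f i) m)) = br (f 0) (f 1).
    by apply/funext => m; apply: br_eq; rewrite selE.
  exact: Cinf_smooth.
exists (MSection pi_smooth) => f g; apply: CinfP => m.
by rewrite poisson_bracketE piE.
Qed.

End TensorOfBracket.

Theorem proposition3p28 (R : realType) (n : nat) (M : manifold R n)
    (phi : diffeo M) :
  (forall br : C^oo(M) -> C^oo(M) -> C^oo(M),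
     purely_hom_poisson_algebra
       (fun f g : C^oo(M) => f * g) br (pullback phi) ->
     (exists pi : msection phi 2, forall f g, br f g = poisson_bracket pi f g) /\
     (forall pi : msection phi 2,
        (forall f g, br f g = poisson_bracket pi f g) ->
        hom_poisson_tensor pi)) /\
  (forall pi : msection phi 2,
     hom_poisson_tensor pi ->
     purely_hom_poisson_algebra
       (fun f g : C^oo(M) => f * g) (poisson_bracket pi) (pullback phi)).
Proof.
split=> [br hbr|pi [hS hAd]].
  split=> [|pi brE]; first exact: tensor_of_bracket hbr.
  have brE2 : br = poisson_bracket pi by apply/funext => f; apply/funext => g.
  subst br; have hL := hom_poisson_lie hbr.
  have hAd : Ad_msection pi = pi by apply/poisson_tensor_Ad; exact: hom_lie_morph hL.
  split=> //; apply/hom_schouten_jacobi => //; exact: hom_lie_jacobi hL.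
split.
- by split=> [f a g h|f a g h]; apply: CinfP => m; rewrite !(CinfD, CinfM, CinfZ); ring.
- exact: mulrC.
- exact: mulrA.
- split.
  + exact: poisson_bracket_bilinear.
  + exact: pullback_linear.
  + exact: poisson_bracket_skew.
  + exact/poisson_tensor_Ad.
  + exact/hom_schouten_jacobi.
- exact: poisson_bracket_leibniz.
Qed.
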